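(* Let $N\ge 0$, $c\in\mathbb{R}$ with $c+1>0$, $b>0$, and let $Q=Q_x\times(0,b)$ where $Q_x$ is an open subset of $\mathbb{R}^N$. Then $$\left\|u\right\|_{L^2_c(Q)}\leq \frac{2b}{c+1}\left\|D_y u\right\|_{L^2_c(Q)}\qquad\text{for all } u\in H^{1,0}_c(Q).$$
   Context: Points of $Q$ are written $z=(x,y)$ with $x\in Q_x$, $0<y<b$. $L^2_c(Q):=L^2(Q,y^c\,dx\,dy)$, $H^1_c(Q):=\{u\in L^2_c(Q):\nabla u\in L^2_c(Q)\}$, where $\nabla u$ is the weak gradient in all variables $(x,y)$ and $D_y u$ is the weak partial derivative in $y$. Functions in $H^1_c(Q)$ have traces $u(\cdot,y)$ for $0\le y\le b$, and $H^{1,0}_c(Q):=\{u\in H^1_c(Q): u=0 \text{ on } y=b\}$, the boundary condition being understood in the sense of traces. *)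

(* Defs.v *)
From HB Require Import structures.
From mathcomp Require Import all_boot all_order all_algebra.
From mathcomp Require Import all_classical all_reals all_analysis.
From mathcomp Require Import measurable_realfun.

Set Implicit Arguments.
Unset Strict Implicit.
Unset Printing Implicit Defensive.

Import Order.TTheory GRing.Theory Num.Theory.
Import numFieldNormedType.Exports.

Local Open Scope classical_set_scope.
Local Open Scope ring_scope.

(* The sigma-algebra on 'rV[R]_n generated by the coordinates, as the library
   does for n.-tuple; it is the Borel sigma-algebra of R^n. *)
Section measurable_rV.
Variables (R : realType) (n : nat).

Let coors (i : 'I_n) (v : 'rV[R]_n) : R := v ord0 i.

Let rV_set0 : g_sigma_preimage coors set0.
Proof. exact: sigma_algebra0. Qed.

Let rV_setC A : g_sigma_preimage coors A -> g_sigma_preimage coors (~` A).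
Proof. exact: sigma_algebraC. Qed.

Let rV_bigcup (F : (set 'rV[R]_n)^nat) :
  (forall i, g_sigma_preimage coors (F i)) ->
  g_sigma_preimage coors (\bigcup_i F i).
Proof. exact: sigma_algebra_bigcup. Qed.

HB.instance Definition _ :=
  @isMeasurable.Build (measure_tuple_display default_measure_display)
    'rV[R]_n (g_sigma_preimage coors) rV_set0 rV_setC rV_bigcup.

End measurable_rV.

Section measurable_rV_theory.
Variable R : realType.

Lemma measurable_coord n (i : 'I_n) :
  measurable_fun [set: 'rV[R]_n] (fun v : 'rV[R]_n => v ord0 i).
Proof.
move=> _ Y mY; rewrite setTI; apply: sub_sigma_algebra => /=.
rewrite -bigcup_seq/=; exists i => /=; first by rewrite mem_index_enum.
by exists Y => //; rewrite setTI.
Qed.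

Lemma measurable_fun_rVP d (T : measurableType d) n (f : T -> 'rV[R]_n) :
  measurable_fun [set: T] f <->
  forall i, measurable_fun [set: T] (fun t => f t ord0 i).
Proof.
split=> [mf i|mf].
  exact: (measurableT_comp (measurable_coord i) mf).
move=> _ A mA; rewrite setTI.
have : image_set_system setT f measurable A; last by rewrite /image_set_system/= setTI.
move: A mA; apply: smallest_sub.
  exact/sigma_algebra_image/sigma_algebra_measurable.
rewrite -bigcup_seq/= => B [i _] [C mC <-].
by rewrite /image_set_system/= !setTI; rewrite -[X in measurable X]setTI; exact: mf.
Qed.

Definition cons_rV n (p : measurableTypeR R * 'rV[R]_n) : 'rV[R]_n.+1 :=
  \row_i oapp (p.2 ord0) p.1 (unlift ord0 i).

Lemma cons_rV0 n (p : measurableTypeR R * 'rV[R]_n) : cons_rV p ord0 ord0 = p.1.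
Proof. by rewrite mxE unlift_none. Qed.

Lemma cons_rVS n (p : measurableTypeR R * 'rV[R]_n) i :
  cons_rV p ord0 (lift ord0 i) = p.2 ord0 i.
Proof. by rewrite mxE liftK. Qed.

Lemma measurable_cons_rV n : measurable_fun [set: measurableTypeR R * 'rV[R]_n] (@cons_rV n).
Proof.
apply/measurable_fun_rVP => i; case: (unliftP ord0 i) => [j ->|->].
  under eq_fun do rewrite cons_rVS.
  exact: (measurableT_comp (measurable_coord j) measurable_snd).
by under eq_fun do rewrite cons_rV0; exact: measurable_fst.
Qed.

Lemma measurable_uncons_rV n : measurable_fun [set: 'rV[R]_n.+1]
  (fun v : 'rV[R]_n.+1 =>
    (v ord0 ord0 : measurableTypeR R,
     \row_j v ord0 (lift ord0 j) : 'rV[R]_n)).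
Proof.
apply: measurable_fun_pair; first exact: measurable_coord.
apply/measurable_fun_rVP => j.
by under eq_fun do rewrite mxE; exact: measurable_coord.
Qed.

Lemma uncons_cons_rV n (p : measurableTypeR R * 'rV[R]_n) :
  (cons_rV p ord0 ord0, \row_j cons_rV p ord0 (lift ord0 j) : 'rV[R]_n) = p.
Proof.
case: p => t v; congr (_, _); first exact: cons_rV0.
by apply/rowP => j; rewrite mxE cons_rVS.
Qed.

End measurable_rV_theory.

Section lebesgue_rV.
Variable R : realType.
Local Open Scope ereal_scope.

Section step.
Variables (n : nat) (m : {sigma_finite_measure set 'rV[R]_n -> \bar R}).

Definition lebesgue_cons : set 'rV[R]_n.+1 -> \bar R :=
  pushforward (@lebesgue_measure R \x m) (@cons_rV R n).

Let mcons := @measurable_cons_rV R n.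

Let lebesgue_cons0 : lebesgue_cons set0 = 0.
Proof. by rewrite /lebesgue_cons /pushforward preimage_set0 measure0. Qed.

Let lebesgue_cons_ge0 A : 0 <= lebesgue_cons A.
Proof. exact: measure_ge0. Qed.

Let lebesgue_cons_sigma_additive : semi_sigma_additive lebesgue_cons.
Proof.
move=> F mF tF mUF; rewrite /lebesgue_cons /pushforward preimage_bigcup.
apply: measure_semi_sigma_additive.
- by move=> k; rewrite -[X in measurable X]setTI; exact: mcons.
- apply/trivIsetP => /= i j _ _ ij; rewrite -preimage_setI.
  by move/trivIsetP : tF => /(_ _ _ _ _ ij) ->//; rewrite preimage_set0.
- by rewrite -preimage_bigcup -[X in measurable X]setTI; exact: mcons.
Qed.

HB.instance Definition _ := isMeasure.Build _ _ _ lebesgue_cons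
  lebesgue_cons0 lebesgue_cons_ge0 lebesgue_cons_sigma_additive.

Let lebesgue_cons_sigma_finite : sigma_finite setT lebesgue_cons.
Proof.
have /sigma_finiteP[F [FT ndF Foo]] := sigma_finiteT (@lebesgue_measure R).
have /sigma_finiteP[G [GT ndG Goo]] := sigma_finiteT m.
pose g (v : 'rV[R]_n.+1) : measurableTypeR R * 'rV[R]_n :=
  (v ord0 ord0, \row_j v ord0 (lift ord0 j)).
have gK : cancel (@cons_rV R n) g by exact: uncons_cons_rV.
exists (fun k => g @^-1` (F k `*` G k)).
  rewrite -preimage_bigcup (_ : \bigcup_k _ = setT) ?preimage_setT//.
  apply/seteqP; split => // -[t v] _.
  have [i _ Fit] : (\bigcup_k F k) t by rewrite -FT.
  have [j _ Gjv] : (\bigcup_k G k) v by rewrite -GT.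
  exists (maxn i j) => //; split => /=.
    by apply: (subsetPset _ _ (ndF i _ (leq_maxl i j))).
  by apply: (subsetPset _ _ (ndG j _ (leq_maxr i j))).
move=> k; have [mF Fkoo] := Foo k; have [mG Gkoo] := Goo k; split.
  rewrite -[X in measurable X]setTI; apply: measurable_uncons_rV => //.
  exact: measurableX.
rewrite /lebesgue_cons /pushforward -comp_preimage.
rewrite (_ : g \o _ = id); last exact/funext.
rewrite preimage_id; apply: (@le_lt_trans _ _ (lebesgue_measure (F k) * m (G k))).
  by rewrite product_measure1E.
by rewrite lte_mul_pinfty// ge0_fin_numE.
Qed.

HB.instance Definition _ := Measure_isSigmaFinite.Build _ _ _ lebesgue_cons
  lebesgue_cons_sigma_finite.

End step.

(* Lebesgue measure on R^n, one coordinate at a time; lebesgue_rV_box below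
   characterizes it. On the one-point space R^0 it has mass 1. *)
Fixpoint lebesgue_rV (n : nat) : {sigma_finite_measure set 'rV[R]_n -> \bar R} :=
  match n with
  | 0 => @dirac _ 'rV[R]_0 0%R R
  | n'.+1 => lebesgue_cons (lebesgue_rV n')
  end.

Lemma lebesgue_rV_box n (A : 'I_n -> set R) : (forall i, measurable (A i)) ->
  lebesgue_rV n [set v : 'rV[R]_n | forall i, A i (v ord0 i)] =
  \prod_(i < n) lebesgue_measure (A i).
Proof.
elim: n A => [|n IH] A mA.
  rewrite big_ord0 /= /dirac indicE mem_set//.
  by case.
rewrite big_ord_recl /= /lebesgue_cons /pushforward.
rewrite -IH; last by move=> i; exact: mA.
rewrite -product_measure1E//=.
- congr (_ _); apply/seteqP; split => -[t v] /=.
    move=> H; split => /=; first by have := H ord0; rewrite cons_rV0.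
    by move=> i; have := H (lift ord0 i); rewrite cons_rVS.
  move=> [/= At Av] i; case: (unliftP ord0 i) => [j ->|->].
    by rewrite cons_rVS; exact: Av.
  by rewrite cons_rV0.
- exact: mA.
- rewrite [X in measurable X](_ : _ = \bigcap_(i in [set: 'I_n])
      ((fun v : 'rV[R]_n => v ord0 i) @^-1` A (lift ord0 i))); last first.
    by apply/seteqP; split=> v /= H i; [move=> _; exact: H|exact: (H i I)].
  apply: fin_bigcap_measurable => // i _.
  by rewrite -[X in measurable X]setTI; apply: measurable_coord => //; exact: mA.
Qed.

End lebesgue_rV.
Arguments lebesgue_rV {R} n.

Section sobolev.
Variables (R : realType) (N : nat).

(* Points z = (x, y) of R^N x R. *)
Local Notation V := ('rV[R]_N * measurableTypeR R)%type.

Definition lebesgue_xy : set V -> \bar R :=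
  (lebesgue_rV N \x @lebesgue_measure R)%E.

HB.instance Definition _ := Measure.on lebesgue_xy.

Section weight.
Variable c : R.
Local Open Scope ereal_scope.

(* The measure y^c dx dy, carried by the half-space y > 0. *)
Definition weighted_measure (A : set V) : \bar R :=
  \int[lebesgue_xy]_(z in A `&` [set z : V | (0 < z.2)%R]) (z.2 `^ c)%:E.

Let weighted_measure0 : weighted_measure set0 = 0.
Proof. by rewrite /weighted_measure set0I integral_set0. Qed.

Let weighted_measure_ge0 A : 0 <= weighted_measure A.
Proof. by apply: integral_ge0 => z _; rewrite lee_fin powR_ge0. Qed.

Let weighted_measure_sigma_additive : semi_sigma_additive weighted_measure.
Proof.
move=> /= F mF tF mUF; rewrite /weighted_measure; apply: cvg_toP.
  apply: ereal_nondecreasing_is_cvgn => m n mn.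
  apply: lee_sum_nneg_natr => // k _ _.
  by apply: integral_ge0 => z _; rewrite lee_fin powR_ge0.
rewrite setI_bigcupl ge0_integral_bigcup//=.
- move=> k; apply: measurableI => //.
  rewrite [X in measurable X](_ : _ = setT `*` `]0%R, +oo[%classic).
    exact: measurableX.
  by apply/seteqP; split => -[x y] /=; rewrite in_itv/= andbT// => -[].
- apply/measurable_EFinP/measurable_funTS.
  apply: (@measurableT_comp _ _ _ _ _ _ (@powR R ^~ c)) => //.
- by move=> z _; rewrite lee_fin powR_ge0.
- exact: trivIset_setIr.
Qed.

HB.instance Definition _ := isMeasure.Build _ _ _ weighted_measure
  weighted_measure0 weighted_measure_ge0 weighted_measure_sigma_additive.

End weight.

(* C^oo: all iterated directional derivatives exist and are differentiable. *)
Definition smooth (phi : 'rV[R]_N * R -> R) :=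
  forall (vs : seq ('rV[R]_N * R)) z,
    differentiable (foldr (fun v f => 'D_v f) phi vs) z.

Definition test_function (Q : set ('rV[R]_N * R)) (phi : 'rV[R]_N * R -> R) :=
  smooth phi /\
  exists K, [/\ compact K, K `<=` Q & forall z, ~ K z -> phi z = 0].

Definition locally_integrable_on (Q : set ('rV[R]_N * R))
    (f : 'rV[R]_N * R -> R) :=
  forall K, compact K -> K `<=` Q ->
    lebesgue_xy.-integrable K (EFin \o f).

(* g is the weak derivative of u on Q in the direction v. *)
Definition weak_derivative (Q : set ('rV[R]_N * R)) (v : 'rV[R]_N * R)
    (u g : 'rV[R]_N * R -> R) :=
  [/\ locally_integrable_on Q u, locally_integrable_on Q g &
    forall phi, test_function Q phi ->
      \int[lebesgue_xy]_(z in Q) (u z * 'D_v phi z) =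
      - \int[lebesgue_xy]_(z in Q) (g z * phi z)].

Definition dir_x (i : 'I_N) : 'rV[R]_N * R := (delta_mx ord0 i, 0).
Definition dir_y : 'rV[R]_N * R := (0, 1).

(* Functions on Q are restrictions of functions on R^N x R, whose values
   outside Q are ignored: f \_ Q is f extended by 0 outside Q. *)
Definition L2norm (c : R) (Q : set ('rV[R]_N * R)) (u : 'rV[R]_N * R -> R)
    : \bar R :=
  'N[weighted_measure c]_2%:E[EFin \o (u \_ Q)].

Definition L2 (c : R) (Q : set ('rV[R]_N * R)) : set ('rV[R]_N * R -> R) :=
  [set u | u \_ Q \in Lfun (weighted_measure c) 2%:E].

Definition H1 (c : R) (Q : set ('rV[R]_N * R)) : set ('rV[R]_N * R -> R) :=
  [set u | [/\ L2 c Q u,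
    forall i : 'I_N, exists2 g, weak_derivative Q (dir_x i) u g & L2 c Q g &
    exists2 g, weak_derivative Q dir_y u g & L2 c Q g]].

Definition cylinder (Qx : set 'rV[R]_N) (b : R) : set ('rV[R]_N * R) :=
  Qx `*` `]0, b[.

(* g is the trace u(., y0) on Qx of a function u on Qx x ]0, b[: the limit of
   u(., y) in L^2(Qx) as y -> y0 within ]0, b[. Elements of H^1_c are only
   defined almost everywhere, hence the limit discards a negligible set of y;
   it is the value at y0 of the representative continuous in y. *)
Definition trace (Qx : set 'rV[R]_N) (b : R) (u : 'rV[R]_N * R -> R) (y0 : R)
    (g : 'rV[R]_N -> R) :=
  g \_ Qx \in Lfun (lebesgue_rV N) 2%:E /\
  forall e : R, 0 < e -> exists2 d : R, 0 < d &
    {ae lebesgue_measure, forall y : R, 0 < y < b -> `|y - y0| < d ->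
      ('N[lebesgue_rV N]_2%:E[EFin \o ((fun x => u (x, y) - g x)%R \_ Qx)]
       <= e%:E)%E}.

Definition H10 (c : R) (Qx : set 'rV[R]_N) (b : R) : set ('rV[R]_N * R -> R) :=
  [set u | H1 c (cylinder Qx b) u /\ trace Qx b u b (cst 0)].

End sobolev.

(* Main.v *)
(* Testing the weak derivative against products psi(x) eta(y), where eta' is a
   bump minus a normalized bump pushed towards y = b, and using that the trace at
   b vanishes, gives, for every box B x I compactly contained in Q,
     int_(B x I) u = - int_B int_0^b Dyu(x, y) |I cap ]0, y]| dy dx.
   By Tonelli the right-hand side is - int_(B x I) int_s^b Dyu(x, y) dy, so by the
   pi-lambda theorem u(x, s) = - int_s^b Dyu(x, y) dy almost everywhere. The claim
   is then the weighted Hardy inequality in y, which follows from Cauchy-Schwarz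
   and Tonelli; Hardy has y^(c + 2) on the right, bounded by b^2 y^c. *)

Require Import Defs.
From HB Require Import structures.
From mathcomp Require Import all_boot all_order all_algebra.
From mathcomp Require Import all_classical all_reals all_analysis.
From mathcomp Require Import measurable_realfun ring lra.

Set Implicit Arguments.
Unset Strict Implicit.
Unset Printing Implicit Defensive.

Import Order.TTheory GRing.Theory Num.Theory.
Import numFieldNormedType.Exports.

Local Open Scope classical_set_scope.
Local Open Scope ring_scope.

(** * Smooth functions *)

(** Test functions must have all iterated directional derivatives and compact support in Q, so every
    cut-off is built explicitly, from e^(-1/x). A primitive of a bump does not vanish near y = b;
    the correction restores compact support at the price of an average of u over a thin strip at b,
    which the trace controls in L^2 and hence, on a box of finite measure, in L^1. Nothing is
    prescribed at y = 0, which is why u is recovered by integrating down from b and every box stays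
    in y > al > 0. There the weight y^c is bounded below whatever the sign of c, so a Dyu in L^2_c
    is integrable on such boxes up to y = b, and this dominates the passage to the limit. Positive
    and negative parts of Dyu are treated separately to make Tonelli available; only |u| <= int_s^b
    |Dyu| is kept in the end. With ga = (c + 1) / 2 the constant in Hardy's inequality is 1 / ga,
    whence b / ga = 2 b / (c + 1). *)

Section smooth_calculus.
Context {R : realType} {V : normedModType R}.
Implicit Types (f g : V -> R) (v : V).

(* On ['rV_N * R] this is convertible to [smooth]. *)
Definition Csmooth f := forall (vs : seq V) z,
  differentiable (foldr (fun v f => 'D_v f) f vs) z.

Lemma Csmooth_differentiable f z : Csmooth f -> differentiable f z.
Proof. by move=> /(_ [::]); exact. Qed.

Lemma Csmooth_derive f v : Csmooth f -> Csmooth ('D_v f).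
Proof. by move=> sf vs z; have := sf (rcons vs v) z; rewrite foldr_rcons. Qed.

Lemma Csmooth_intro f : (forall z, differentiable f z) ->
  (forall v, Csmooth ('D_v f)) -> Csmooth f.
Proof.
move=> df sf vs; case/lastP: vs => [|vs v] z; first exact: df.
by rewrite foldr_rcons; exact: sf.
Qed.

(** Coinduction principle: smooth functions form the largest class of differentiable functions
    stable under directional derivatives, so one stable class containing [f] is a certificate. *)
Lemma Csmooth_coind (C : set (V -> R)) :
  (forall f, C f -> forall z, differentiable f z) ->
  (forall f v, C f -> C ('D_v f)) -> forall f, C f -> Csmooth f.
Proof.
move=> Cdiff CD f Cf vs; elim/last_ind: vs f Cf => [f Cf z|vs v IH f Cf z].
  exact: Cdiff.
by rewrite foldr_rcons; apply: IH; exact: CD.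
Qed.

(** The Leibniz rule sends a product to a sum of products, so neither sums nor products alone give a
    class stable under derivation; the algebra generated by smooth functions does, and
    [Csmooth_coind] applies to it. *)
Inductive smooth_alg : (V -> R) -> Prop :=
| smooth_alg_base f : Csmooth f -> smooth_alg f
| smooth_algD f g : smooth_alg f -> smooth_alg g -> smooth_alg (f + g)
| smooth_algM f g : smooth_alg f -> smooth_alg g -> smooth_alg (f * g).

Lemma smooth_alg_smooth f : smooth_alg f -> Csmooth f.
Proof.
have dA f0 : smooth_alg f0 -> forall z, differentiable f0 z.
  elim=> [h sh z|h k _ IH _ IH' z|h k _ IH _ IH' z].
  - exact: Csmooth_differentiable.
  - exact: differentiableD.
  - exact: differentiableM.
move: f; apply: Csmooth_coind => // f v; elim=> {f}[h sh|h k sh IH sk IH'|h k sh IH sk IH'].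
- by apply: smooth_alg_base; exact: Csmooth_derive.
- rewrite (_ : 'D_v _ = 'D_v h + 'D_v k); first exact: smooth_algD.
  by apply/funext => z; rewrite deriveD//; apply: diff_derivable; exact: dA.
- rewrite (_ : 'D_v _ = h * 'D_v k + k * 'D_v h).
    by apply: smooth_algD; apply: smooth_algM.
  by apply/funext => z; rewrite deriveM//; apply: diff_derivable; exact: dA.
Qed.

Lemma CsmoothD f g : Csmooth f -> Csmooth g -> Csmooth (f + g).
Proof. by move=> sf sg; apply: smooth_alg_smooth; apply: smooth_algD; exact: smooth_alg_base. Qed.

Lemma CsmoothM f g : Csmooth f -> Csmooth g -> Csmooth (f * g).
Proof. by move=> sf sg; apply: smooth_alg_smooth; apply: smooth_algM; exact: smooth_alg_base. Qed.

Lemma Csmooth_cst (a : R) : Csmooth (cst a).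
Proof.
apply: (@Csmooth_coind [set f | exists b, f = cst b]); last by exists a.
  by move=> f [b ->] z; exact: differentiable_cst.
by move=> f v [b ->]; exists 0; apply/funext => z; rewrite derive_cst.
Qed.

Lemma CsmoothZ (a : R) f : Csmooth f -> Csmooth (fun z => a * f z).
Proof. by move=> sf; apply: (@CsmoothM (cst a)) => //; exact: Csmooth_cst. Qed.

Lemma Csmooth_prod (I : Type) (s : seq I) (F : I -> V -> R) :
  (forall i, Csmooth (F i)) -> Csmooth (fun z => \prod_(i <- s) F i z).
Proof.
move=> sF; elim: s => [|i s IH].
  by under eq_fun do rewrite big_nil; exact: Csmooth_cst.
by under eq_fun do rewrite big_cons; exact: CsmoothM.
Qed.

End smooth_calculus.

Section smooth_comp.
Context {R : realType} {V : normedModType R}.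

Lemma derive_comp_line (f : R -> R) (l : V -> R) (v z : V) :
  differentiable f (l z) -> differentiable l z ->
  'D_v (f \o l) z = 'D_v l z * 'D_1 f (l z).
Proof.
move=> df dl.
rewrite deriveE; last exact: differentiable_comp.
have -> : 'd (f \o l) z v = 'd f (l z) ('d l z v) by rewrite diff_comp.
rewrite (deriveE v dl) (deriveE (1 : R) df).
by rewrite -[in LHS](mulr1 ('d l z v)) -['d l z v * 1]/('d l z v *: (1 : R)) linearZ.
Qed.

(** Since the derivative of [l] in a direction [v] is the constant [l' v], every derivative of
    [f \o l] is a scalar times [g \o l] with [g] smooth; such functions form the stable class. *)
Lemma Csmooth_comp_affine (f : R -> R) (l : V -> R) (l' : V -> R) :
  Csmooth f -> (forall z, differentiable l z) ->
  (forall v z, 'D_v l z = l' v) -> Csmooth (f \o l).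
Proof.
move=> sf dl l'E.
apply: (@Csmooth_coind _ _ [set h | exists a g, Csmooth g /\ h = fun z => a * (g (l z))]).
- move=> _ [a [g [sg ->]]] z; apply: (@differentiableM _ _ (cst a) (g \o l)).
    exact: differentiable_cst.
  by apply: differentiable_comp => //; exact: Csmooth_differentiable.
- move=> _ v [a [g [sg ->]]]; exists (a * l' v), ('D_1 g); split; first exact: Csmooth_derive.
  apply/funext => z.
  have dgl : differentiable (g \o l) z.
    by apply: differentiable_comp => //; exact: Csmooth_differentiable.
  rewrite (_ : (fun z => _) = a *: (g \o l)); last by [].
  rewrite deriveZ; last exact: diff_derivable.
  by rewrite derive_comp_line// ?l'E; [rewrite -mulrA|exact: Csmooth_differentiable].
- by exists 1, f; split => //; apply/funext => z; rewrite mul1r.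
Qed.

End smooth_comp.

Section smooth_real.
Context {R : realType}.

Lemma derive_dir (f : R -> R) (v x : R) : differentiable f x ->
  'D_v f x = v * 'D_1 f x.
Proof.
move=> df; rewrite !deriveE// -[in LHS](mulr1 v) -[v * 1]/(v *: (1:R)).
by rewrite linearZ.
Qed.

Lemma Csmooth_antiderivative (F f : R -> R) : Csmooth f ->
  (forall x : R, is_derive x 1 F (f x)) -> Csmooth F.
Proof.
move=> sf dF.
have diF x : differentiable F x by apply/derivable1_diffP; have [] := dF x.
apply: Csmooth_intro => // v.
rewrite (_ : 'D_v F = fun x => v * f x); first exact: CsmoothZ.
by apply/funext => x; rewrite derive_dir//; congr (_ * _); have [] := dF x.
Qed.

Lemma Csmooth_affine (f : R -> R) (k a : R) : Csmooth f ->
  Csmooth (fun x => f (k * (x - a))).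
Proof.
have dk (z : R) : is_derive z (1 : R) (fun x : R => k * (x - a)) k.
  have : is_derive z (1 : R) (fun x : R => k *: (x - a)) (k *: (1 - 0)).
    exact: is_deriveZ.
  by rewrite subr0 [k *: 1]mulr1.
have dfk z : differentiable (fun x : R => k * (x - a)) z.
  by apply/derivable1_diffP; have [] := dk z.
move=> sf; apply: (@Csmooth_comp_affine _ _ f (fun x => k * (x - a)) (fun v => v * k)) => //.
by move=> v z; rewrite derive_dir//; congr (_ * _); have [_ ->] := dk z.
Qed.

(* These functions form a class closed under derivation, see [flat_derive]. *)
Definition flat (p : {poly R}) (x : R) : R :=
  if 0 < x then p.[x^-1] * expR (- x^-1) else 0.

(** A single term of the exponential series, e^t >= t^(n+2) / (n+2)!. The two spare powers of t
    become the factor x^2 of [flat_bound] when t = 1/x. *)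
Lemma expXn_bound (n : nat) (t : R) : 0 < t -> t ^+ n * expR (- t) <= n.+2`!%:R / t ^+ 2.
Proof.
move=> t0; rewrite expRN ler_pdivrMr ?expR_gt0// mulrAC ler_pdivlMr ?exprn_gt0//.
rewrite -exprD addn2 -ler_pdivrMl ?ltr0n ?fact_gt0// mulrC.
have := @expR_ge1Dxn R t n.+1 (ltW t0).
by apply: le_trans; rewrite lerDr.
Qed.

(** Coefficientwise from [expXn_bound]. A quadratic bound is what forces the derivative at 0 to
    exist and vanish. *)
Lemma flat_bound (p : {poly R}) : exists2 C : R, 0 <= C & forall x, `|flat p x| <= C * x ^+ 2.
Proof.
exists (\sum_(i < size p) `|p`_i| * i.+2`!%:R).
  by apply: sumr_ge0 => i _; rewrite mulr_ge0.
move=> x; rewrite /flat; case: ifPn => x0; last first.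
  by rewrite normr0 mulr_ge0 ?sqr_ge0//; apply: sumr_ge0 => i _; rewrite mulr_ge0.
rewrite horner_coef mulr_suml mulr_suml (le_trans (ler_norm_sum _ _ _))//.
apply: ler_sum => i _; rewrite -mulrA normrM -mulrA ler_wpM2l//.
rewrite ger0_norm ?mulr_ge0 ?expR_ge0 ?exprn_ge0 ?invr_ge0 ?(ltW x0)//.
have := @expXn_bound i x^-1; rewrite invr_gt0 => /(_ x0).
by rewrite [x^-1 ^+ 2]exprVn invrK.
Qed.

(** For x > 0 put t = 1/x, so that dt/dx = - t^2 and the derivative of p(t) e^(-t) is (p - p')(t)
    t^2 e^(-t): the class is stable with an explicit new polynomial. *)
Lemma flat_derive (p : {poly R}) (x : R) :
  is_derive x (1 : R) (flat p) (flat ((p - p^`()) * 'X^2) x).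
Proof.
have [x0|x0|->] := ltgtP x 0.
- rewrite [X in is_derive _ _ _ X](_ : _ = 0); last first.
    by rewrite /flat ltNge (ltW x0).
  apply: (@near_eq_is_derive _ _ _ (cst 0)).
  near=> y; rewrite /flat ifF//; apply/negbTE; rewrite -leNgt ltW//.
  by near: y; exact: lt_nbhsl.
- have xN0 : x != 0 by rewrite gt_eqF.
  apply: (@near_eq_is_derive _ _ _ (fun y : R => p.[y^-1] * expR (- y^-1))).
    near=> y; rewrite /flat ifT//.
    by near: y; exact: lt_nbhsr.
  have dV : is_derive x (1 : R) (fun y : R => y^-1) (- x ^- 2 *: 1).
    exact: is_deriveV.
  have dp : is_derive x (1 : R) (fun y : R => p.[y^-1]) ((p^`()).[x^-1] * (- x ^- 2 *: 1)).
    exact: (@is_derive1_comp _ (horner p) (fun y : R => y^-1)).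
  have de : is_derive x (1 : R) (fun y : R => expR (- y^-1)) (expR (- x^-1) * (- (- x ^- 2 *: 1))).
    by apply: (@is_derive1_comp _ expR (fun y : R => - y^-1)).
  rewrite [X in is_derive _ _ _ X](_ : _ = p.[x^-1] *: (expR (- x^-1) * (- (- x ^- 2 *: 1))) +
     expR (- x^-1) *: ((p^`()).[x^-1] * (- x ^- 2 *: 1))).
    exact: is_deriveM.
  rewrite /flat x0 !hornerE -!exprVn /GRing.scale/=.
  set E := expR _; set a := p.[_]; set b := p^`().[_]; set t := x^-1.
  ring.
- rewrite [X in is_derive _ _ _ X](_ : _ = 0); last by rewrite /flat ltxx.
  have [C C0 HC] := flat_bound p.
  (* At the junction point the difference quotient is at most C |h| in absolute value, by the
     quadratic bound. *)
  have cv : h^-1 *: ((flat p \o shift 0) (h *: 1) - flat p 0) @[h --> (0 : R)^'] --> (0 : R).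
    apply/cvgrPdist_le => /= e e0; near=> h.
    have h0 : h != 0 by near: h; exact: nbhs_dnbhs_neq.
    rewrite {2}/flat ltxx subr0 addr0 sub0r normrN [h *: 1]mulr1 normrM normfV.
    rewrite ler_pdivrMl ?normr_gt0// (le_trans (HC _))//.
    rewrite -[h ^+ 2]ger0_norm ?sqr_ge0// normrX expr2 mulrCA ler_wpM2l//.
    rewrite (@le_trans _ _ ((C + 1) * `|h|)) ?ler_wpM2r ?lerDl//.
    rewrite mulrC -ler_pdivlMr ?ltr_wpDl//; near: h; apply: dnbhs0_le.
    by rewrite divr_gt0// ltr_wpDl.
  apply: DeriveDef; first by apply/cvg_ex; exists 0.
  exact/cvg_lim.
Unshelve. all: by end_near.
Qed.

Lemma Csmooth_flat (p : {poly R}) : Csmooth (flat p).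
Proof.
apply: (@Csmooth_coind _ _ [set f | exists q, f = flat q]); last by exists p.
  move=> _ [q ->] z; apply/derivable1_diffP; have [] := flat_derive q z; exact.
move=> _ v [q ->]; exists (v *: ((q - q^`()) * 'X^2)); apply/funext => x.
rewrite derive_dir; last by apply/derivable1_diffP; have [] := flat_derive q x.
have [_ ->] := flat_derive q x.
by rewrite /flat; case: ifPn => _; rewrite ?mulr0// hornerZ mulrA.
Qed.

(** The classical function equal to e^(-1/x) for x > 0 and to 0 elsewhere. *)
Definition expflat : R -> R := flat 1.

Lemma expflatE (x : R) : expflat x = if 0 < x then expR (- x^-1) else 0.
Proof. by rewrite /expflat /flat hornerC mul1r. Qed.

Lemma expflat_ge0 (x : R) : 0 <= expflat x.
Proof. by rewrite expflatE; case: ifPn => // _; exact: expR_ge0. Qed.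

Lemma expflat_le1 (x : R) : expflat x <= 1.
Proof.
rewrite expflatE; case: ifPn => // x0.
by rewrite -expR0 ler_expR oppr_le0 invr_ge0 ltW.
Qed.

Lemma expflat_gt0 (x : R) : 0 < x -> 0 < expflat x.
Proof. by move=> x0; rewrite expflatE x0 expR_gt0. Qed.

Lemma expflat_eq0 (x : R) : x <= 0 -> expflat x = 0.
Proof. by rewrite expflatE leNgt; case: ifPn. Qed.

(** Dilations of [expflat] increase to the indicator of the open half-line; this is the source of
    all the approximants below. *)
Lemma cvg_expflat (x : R) : 0 < x -> expflat (k.+1%:R * x) @[k --> \oo] --> (1 : R).
Proof.
move=> x0.
have : expR (- (k.+1%:R^-1 * x^-1)) @[k --> \oo] --> expR (- (0 * x^-1) : R).
  apply: continuous_cvg; first exact: continuous_expR.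
  by apply: cvgN; apply: cvgMl; exact: cvg_harmonic.
rewrite mul0r oppr0 expR0; apply: cvg_trans; apply: near_eq_cvg.
by near=> k; rewrite expflatE mulr_gt0// invfM.
Unshelve. all: by end_near.
Qed.

Lemma Csmooth_continuous (f : R -> R) : Csmooth f -> continuous f.
Proof. by move=> sf x; apply: differentiable_continuous; exact: Csmooth_differentiable. Qed.

End smooth_real.

(** * Pointwise approximation of indicators by smooth functions *)

Section approximable.
Context {R : realType}.

(* Open intervals are smoothly approximable, and products of the approximants
   show closure under intersection: boxes with such sides form a pi-system that
   can be tested against smooth functions, without any mollification. *)
Definition smooth_approximable (A : set R) :=
  exists rho : nat -> R -> R, [/\ forall k, Csmooth (rho k),
    forall k x, 0 <= rho k x <= 1, forall k x, ~ A x -> rho k x = 0 &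
    forall x, A x -> rho k x @[k --> \oo] --> (1 : R)].

Lemma smooth_approximableT : smooth_approximable setT.
Proof.
exists (fun=> cst 1); split => //.
- by move=> _; exact: Csmooth_cst.
- by move=> _ x /=; rewrite ler01 lexx.
- by move=> _ x /(_ I).
- by move=> x _; exact: cvg_cst.
Qed.

Lemma smooth_approximableI (A B : set R) : smooth_approximable A ->
  smooth_approximable B -> smooth_approximable (A `&` B).
Proof.
move=> [f [sf f01 f0 f1]] [g [sg g01 g0 g1]]; exists (fun k => f k * g k); split => //.
- by move=> k; exact: CsmoothM.
- move=> k x; have /andP[a b] := f01 k x; have /andP[c d] := g01 k x.
  by rewrite /GRing.mul/= mulr_ge0//= mulr_ile1.
- move=> k x /not_andP[/f0|/g0] h; rewrite /GRing.mul/= h ?mul0r ?mulr0//.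
- move=> x [/f1 fx /g1 gx]; rewrite -[1]mulr1; exact: cvgM.
Qed.

Lemma smooth_approximable_itvoy (a : R) : smooth_approximable `]a, +oo[.
Proof.
exists (fun k x => expflat (k.+1%:R * (x - a))); split.
- by move=> k; apply: Csmooth_affine; exact: Csmooth_flat.
- by move=> k x; rewrite expflat_ge0 expflat_le1.
- move=> k x; rewrite /= in_itv/= andbT => /negP; rewrite -leNgt => xa.
  by rewrite expflat_eq0// mulr_ge0_le0// subr_le0.
- by move=> x; rewrite /= in_itv/= andbT => ax; apply: cvg_expflat; rewrite subr_gt0.
Qed.

Lemma smooth_approximable_itvNyo (a : R) : smooth_approximable `]-oo, a[.
Proof.
exists (fun k x => expflat ((- k.+1%:R) * (x - a))); split.
- by move=> k; apply: Csmooth_affine; exact: Csmooth_flat.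
- by move=> k x; rewrite expflat_ge0 expflat_le1.
- move=> k x; rewrite /= in_itv/= => /negP; rewrite -leNgt => xa.
  by rewrite expflat_eq0// mulNr oppr_le0 mulr_ge0// subr_ge0.
- move=> x; rewrite /= in_itv/= => ax; under eq_fun do rewrite mulNr -mulrN opprB.
  by apply: cvg_expflat; rewrite subr_gt0.
Qed.

Lemma smooth_approximable_itvoo (a b : R) : smooth_approximable `]a, b[.
Proof.
have -> : `]a, b[%classic = `]a, +oo[ `&` `]-oo, b[.
  apply/seteqP; split=> x /=; rewrite !in_itv/= ?andbT; first by move=> /andP[].
  by move=> [-> ->].
by apply: smooth_approximableI; [exact: smooth_approximable_itvoy|exact: smooth_approximable_itvNyo].
Qed.

(** [A] is the union of the sets where [f k] is positive: each [f k] vanishes off [A], and at a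
    point of [A] it is eventually positive. *)
Lemma measurable_smooth_approximable (A : set R) : smooth_approximable A -> measurable A.
Proof.
move=> [f [sf f01 f0 f1]].
have mf k : measurable_fun setT (f k).
  by apply: continuous_measurable_fun; exact: Csmooth_continuous.
rewrite (_ : A = \bigcup_k (f k @^-1` `]0, +oo[)).
  by apply: bigcup_measurable => k _; rewrite -[X in measurable X]setTI; apply: mf.
apply/seteqP; split => x; last first.
  move=> [k _ /=]; rewrite in_itv/= andbT; apply: contraPP => /f0 ->.
  by rewrite ltxx.
move=> /f1 /cvgr_gt /(_ 0 ltr01) [k _ /(_ k (leqnn k)) fk]; exists k => //=.
by rewrite in_itv/= andbT.
Qed.

End approximable.

(** * Bumps on the line and their primitives *)

Section primitive.
Context {R : realType}.
Local Notation mu := (@lebesgue_measure R).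

Definition primitive (rho : R -> R) (y : R) : R :=
  (\int[mu]_(t in `]-oo, y]) rho t)%R.

Section bump.
Variables (rho : R -> R) (a b : R).
Hypotheses (srho : Csmooth rho) (rho01 : forall x, 0 <= rho x <= 1).
Hypothesis rho0 : forall x, ~ `]a, b[%classic x -> rho x = 0.

Let mrho : measurable_fun setT rho.
Proof. by apply: continuous_measurable_fun; exact: Csmooth_continuous. Qed.

Let le_rho_indic x : ((rho x)%:E <= (\1_`]a, b[ x)%:E :> \bar R)%E.
Proof.
rewrite lee_fin indicE; case: (boolP (x \in `]a, b[%classic)) => [_|].
  by have /andP[] := rho01 x.
by rewrite notin_setE => /rho0 ->.
Qed.

Let int_indic : (\int[mu]_x (\1_`]a, b[ x)%:E < +oo)%E.
Proof.
suff h : (mu `]a, b[ < +oo)%E by rewrite integral_indic// setIT.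
by rewrite lebesgue_measure_itv/=; case: ifPn => // _; exact: ltry.
Qed.

Lemma bump_integrable D : measurable D -> mu.-integrable D (EFin \o rho).
Proof.
move=> mD; apply: (@integrableS _ _ _ _ setT) => //.
apply/integrableP; split; first exact/measurable_EFinP.
apply: le_lt_trans int_indic; apply: ge0_le_integral => //.
- by apply: measurableT_comp => //; exact/measurable_EFinP.
- exact/measurable_EFinP.
- by move=> x _ /=; rewrite ger0_norm ?le_rho_indic//; have /andP[] := rho01 x.
Qed.

Lemma is_derive_primitive (y : R) : is_derive y (1 : R) (primitive rho) (rho y).
Proof.
have yy1 : y < y + 1 by rewrite ltrDl.
have [|dP P'] := continuous_FTC1 yy1 (bump_integrable (measurable_itv `]-oo, y + 1])) (ltNyr _).
  exact: Csmooth_continuous.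
by split; [exact: dP|rewrite -derive1E; exact: P'].
Qed.

Lemma primitive_eq0 (y : R) : y <= a -> primitive rho y = 0.
Proof.
move=> ya; rewrite /primitive /Rintegral integral0_eq// => x /=.
rewrite in_itv/= => xy; rewrite rho0//= in_itv/= => /andP[].
by rewrite ltNge (le_trans xy).
Qed.

Lemma primitive_ge_end (y : R) : b <= y -> (primitive rho y)%:E = (\int[mu]_x (rho x)%:E)%E.
Proof.
move=> bry; rewrite /primitive fineK; last first.
  by apply: integrable_fin_num => //; exact: bump_integrable.
rewrite integral_mkcond; apply: eq_integral => x _; rewrite patchE.
case: ifPn => //; rewrite notin_setE/= in_itv/= => /negP; rewrite -ltNge => yx.
by rewrite rho0//= in_itv/= => /andP[_]; rewrite ltNge ltW// (le_lt_trans bry).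
Qed.

Lemma primitive_ge0 (y : R) : 0 <= primitive rho y.
Proof. by apply: Rintegral_ge0 => x _; have /andP[] := rho01 x. Qed.

Lemma primitive_le (y : R) : a <= b -> primitive rho y <= b - a.
Proof.
move=> ab; rewrite -lee_fin /primitive fineK; last first.
  by apply: integrable_fin_num => //; exact: bump_integrable.
apply: (@le_trans _ _ (\int[mu]_(x in `]-oo, y]) (\1_`]a, b[ x)%:E)%E).
  apply: ge0_le_integral => //.
  - by move=> x _; rewrite lee_fin; have /andP[] := rho01 x.
  - by apply/measurable_EFinP; exact: measurable_funTS.
  - exact/measurable_EFinP.
rewrite integral_indic//; apply: (@le_trans _ _ (mu `]a, b[)).
  by apply: le_measure; rewrite ?inE//; exact: measurableI.
by rewrite lebesgue_measure_itv/=; case: ifPn => //; rewrite lte_fin -leNgt lee_fin subr_ge0.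
Qed.

End bump.

(** Dominated convergence under the indicator of []a, b[]. The limit is the length of the part of
    [A] below [y], the kernel through which Dyu enters the box identity. *)
Lemma cvg_primitive (A : set R) (rho : nat -> R -> R) (a b : R) :
  (forall k, Csmooth (rho k)) -> (forall k x, 0 <= rho k x <= 1) ->
  (forall k x, ~ A x -> rho k x = 0) ->
  (forall x, A x -> rho k x @[k --> \oo] --> (1 : R)) ->
  measurable A -> A `<=` `]a, b[ -> forall y,
  primitive (rho k) y @[k --> \oo] --> fine (mu (A `&` `]-oo, y])).
Proof.
move=> srho rho01 rho0 rho1 mA Aab y.
have mrho k : measurable_fun setT (rho k).
  by apply: continuous_measurable_fun; exact: Csmooth_continuous.
have I1 : mu.-integrable `]-oo, y] (EFin \o \1_`]a, b[).
  apply: (@integrableS _ _ _ _ setT) => //.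
  apply/integrableP; split; first exact/measurable_EFinP.
  under eq_integral => x _ do rewrite /= ger0_norm//.
  suff h : (mu `]a, b[ < +oo)%E by rewrite integral_indic// setIT.
  by rewrite lebesgue_measure_itv/=; case: ifPn => // _; exact: ltry.
have : (\int[mu]_(t in `]-oo, y]) (rho k t)%:E @[k --> \oo] -->
        \int[mu]_(t in `]-oo, y]) (\1_A t)%:E)%E.
  apply: (dominated_cvg _ _ _ _ I1) => //.
  - move=> k; have mk : measurable_fun `]-oo, y] (EFin \o rho k).
      by apply/measurable_EFinP; exact: measurable_funTS.
    exact: mk.
  - move=> x _; apply: cvg_EFin; first exact: nearW.
    rewrite indicE; case: (boolP (x \in A)) => [|]; first by rewrite inE => /rho1.
    rewrite notin_setE => Ax; under eq_cvg do rewrite /= rho0//.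
    exact: cvg_cst.
  - move=> k x _; rewrite abse_EFin lee_fin ger0_norm; last by have /andP[] := rho01 k x.
    rewrite indicE; case: (boolP (x \in `]a, b[%classic)) => [_|].
      by have /andP[] := rho01 k x.
    by rewrite notin_setE => xab; rewrite rho0// => /Aab.
have fA : mu (A `&` `]-oo, y]) \is a fin_num.
  rewrite ge0_fin_numE//; apply: (@le_lt_trans _ _ (mu `]a, b[)).
    by apply: le_measure; rewrite ?inE//; [exact: measurableI|move=> x [/Aab]].
  by rewrite lebesgue_measure_itv/=; case: ifPn => // _; exact: ltry.
rewrite integral_indic// => h; apply: fine_cvg; rewrite fineK//; exact: h.
Qed.

(** A probability density carried by []a, d[] together with its distribution function, a smooth step
    from 0 to 1: the product of two opposite copies of [expflat], divided by its mass. *)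
Lemma normalized_bump (a d : R) : a < d -> exists sigma Sigma : R -> R,
  [/\ Csmooth sigma, exists C, forall y, sigma y <= C,
      forall y, is_derive y (1 : R) Sigma (sigma y) & forall y, 0 <= sigma y] /\
  (forall y, ~ `]a, d[%classic y -> sigma y = 0) /\
      [/\ forall y, y <= a -> Sigma y = 0, forall y, d <= y -> Sigma y = 1,
      forall y, 0 <= Sigma y <= 1 & (\int[mu]_y (sigma y)%:E = 1)%E].
Proof.
move=> ad.
pose rho (y : R) := expflat (1 * (y - a)) * expflat (- 1 * (y - d)).
have rhoE y : rho y = expflat (y - a) * expflat (d - y).
  by rewrite /rho mul1r mulN1r opprB.
have srho : Csmooth rho.
  by apply: CsmoothM; apply: Csmooth_affine; exact: Csmooth_flat.
have rho01 y : 0 <= rho y <= 1.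
  rewrite rhoE mulr_ge0 ?expflat_ge0//=.
  by rewrite mulr_ile1 ?expflat_ge0 ?expflat_le1.
have mrho : measurable_fun setT (EFin \o rho).
  apply/measurable_EFinP; apply: continuous_measurable_fun.
  exact: Csmooth_continuous srho.
have rho0 y : ~ `]a, d[%classic y -> rho y = 0.
  rewrite rhoE /= in_itv/= => /negP; rewrite negb_and -!leNgt => /orP[h|h].
    by rewrite (@expflat_eq0 _ (y - a)) ?mul0r// subr_le0.
  by rewrite (@expflat_eq0 _ (d - y)) ?mulr0// subr_le0.
have dP := is_derive_primitive srho rho01 rho0.
have cP : continuous (primitive rho).
  by move=> y; apply: differentiable_continuous; apply/derivable1_diffP; have [] := dP y.
pose m := primitive rho d.
(* The mass is positive by the mean value theorem: it equals d - a times the value of [rho] at an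
   interior point, where both factors are positive. *)
have m0 : 0 < m.
  have [|x xad] := @MVT _ (primitive rho) rho a d ad (fun x _ => dP x).
    exact: continuous_subspaceT.
  rewrite (primitive_eq0 rho0 (lexx a)) subr0 /m => ->.
  rewrite mulr_gt0 ?subr_gt0// rhoE.
  by move: xad; rewrite in_itv/= => /andP[ax xd]; rewrite mulr_gt0// expflat_gt0// subr_gt0.
have mE := primitive_ge_end srho rho01 rho0.
have P_le y : primitive rho y <= m.
  rewrite -lee_fin [X in (_ <= X)%E]mE// /primitive fineK; last first.
    by apply: integrable_fin_num => //; exact: (bump_integrable srho rho01 rho0).
  apply: (@ge0_subset_integral _ _ _ mu `]-oo, y] setT _ _ (EFin \o rho)) => //.
  by move=> x _; rewrite lee_fin; have /andP[] := rho01 x.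
have dS y : is_derive y (1 : R) (fun y => m^-1 * primitive rho y) (m^-1 * rho y).
  exact: (@is_deriveZ _ _ _ (primitive rho) m^-1 y (1 : R) (rho y)).
exists (fun y => m^-1 * rho y), (fun y => m^-1 * primitive rho y); split; [split|split] => //.
- exact: CsmoothZ.
- exists m^-1 => y; have /andP[_ r1] := rho01 y.
  by rewrite ler_piMr// invr_ge0 ltW.
- by move=> y; rewrite mulr_ge0 ?invr_ge0 ?(ltW m0)//; have /andP[] := rho01 y.
- by move=> y /rho0 ->; rewrite mulr0.
- split.
  + by move=> y /(primitive_eq0 rho0) ->; rewrite mulr0.
  + move=> y dy; suff -> : primitive rho y = m by rewrite mulVf ?gt_eqF.
    by apply: EFin_inj; rewrite !mE.
  + move=> y; rewrite mulr_ge0 ?invr_ge0 ?(ltW m0) ?primitive_ge0//=.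
    by rewrite ler_pdivrMl// mulr1.
  + under eq_integral do rewrite EFinM.
    rewrite ge0_integralZl//.
    * by rewrite -(mE d)// -EFinM mulVf ?gt_eqF.
    * by move=> x _; rewrite lee_fin; have /andP[] := rho01 x.
    * by rewrite lee_fin invr_ge0 ltW.
Qed.

End primitive.

(** * Tensor test functions *)

Section tensor.
Context {R : realType} {N : nat}.
Local Notation V := ('rV[R]_N * R)%type.

Definition coord_x (i : 'I_N) (z : V) : R := z.1 ord0 i.

Lemma coord_x_linear i : linear (coord_x i).
Proof. by move=> a u v; rewrite /coord_x /= !mxE. Qed.

HB.instance Definition _ i := GRing.isLinear.Build R V R _ (coord_x i) (coord_x_linear i).

Definition coord_y (z : V) : R := z.2.

Lemma coord_y_linear : linear coord_y.
Proof. by []. Qed.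

HB.instance Definition _ := GRing.isLinear.Build R V R _ coord_y coord_y_linear.

Lemma continuous_coord_x i : continuous (coord_x i).
Proof.
move=> z; apply: (@continuous_comp _ _ _ fst (fun M : 'rV[R]_N => M ord0 i)).
  exact: cvg_fst.
exact: coord_continuous.
Qed.

Lemma continuous_coord_y : continuous coord_y.
Proof. by move=> z; exact: cvg_snd. Qed.

Lemma derive_linear (l : {linear V -> R}) v z : continuous l -> 'D_v l z = l v.
Proof.
move=> cl; rewrite deriveE; last exact: linear_differentiable.
by rewrite diff_lin.
Qed.

Definition tensor (psi : 'I_N -> R -> R) (x : 'rV[R]_N) : R :=
  \prod_(i < N) psi i (x ord0 i).

Lemma Csmooth_tensor (psi : 'I_N -> R -> R) : (forall i, Csmooth (psi i)) ->
  Csmooth (fun z : V => tensor psi z.1).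
Proof.
move=> spsi; apply: Csmooth_prod => i.
apply: (@Csmooth_comp_affine _ _ (psi i) (coord_x i) (coord_x i)) => //.
  by move=> z; apply: linear_differentiable; exact: continuous_coord_x.
by move=> v z; apply: derive_linear; exact: continuous_coord_x.
Qed.

Lemma Csmooth_snd (eta : R -> R) : Csmooth eta -> Csmooth (fun z : V => eta z.2).
Proof.
move=> seta.
apply: (@Csmooth_comp_affine _ _ eta coord_y coord_y) => //.
  by move=> z; apply: linear_differentiable; exact: continuous_coord_y.
by move=> v z; apply: derive_linear; exact: continuous_coord_y.
Qed.

Lemma derive_tensor (psi : 'I_N -> R -> R) (eta : R -> R) z :
  (forall i, Csmooth (psi i)) -> Csmooth eta ->
  'D_(dir_y R N) (fun z : V => tensor psi z.1 * eta z.2) z =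
  tensor psi z.1 * 'D_(1 : R) eta z.2.
Proof.
move=> spsi seta.
have st := Csmooth_tensor spsi.
have se := Csmooth_snd seta.
have -> : (fun z : V => tensor psi z.1 * eta z.2) =
  (fun z : V => tensor psi z.1) * (fun z : V => eta z.2) by [].
rewrite deriveM; last 2 first.
- by apply: diff_derivable; exact: Csmooth_differentiable.
- by apply: diff_derivable; exact: Csmooth_differentiable.
(* The direction has zero x-component, so the difference quotient of the x-factor is that of a
   constant. *)
have -> : 'D_(dir_y R N) (fun z : V => tensor psi z.1) z = 0.
  rewrite -(@derive_cst R V R (tensor psi z.1) z (dir_y R N)); congr (lim _).
  rewrite funeqE => A; congr (nbhs _ _); apply/funext => h /=.
  by rewrite /shift /dir_y /= scaler0 add0r.
by rewrite scaler0 addr0; congr (_ * _).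
Qed.

Definition box (A : 'I_N -> set R) : set 'rV[R]_N :=
  [set v | forall i, A i (v ord0 i)].

Lemma compact_box (A : 'I_N -> set R) : (forall i, compact (A i)) -> compact (box A).
Proof. exact: rV_compact. Qed.

Lemma measurable_box (A : 'I_N -> set R) : (forall i, measurable (A i)) -> measurable (box A).
Proof.
move=> mA; rewrite [X in measurable X](_ : _ = \bigcap_(i in [set: 'I_N])
      ((fun v : 'rV[R]_N => v ord0 i) @^-1` A i)).
  apply: fin_bigcap_measurable => // i _.
  by rewrite -[X in measurable X]setTI; apply: measurable_coord => //; exact: mA.
by apply/seteqP; split=> v /= H i; [move=> _; exact: H|exact: (H i I)].
Qed.

Lemma box_segment_fin (p q : 'I_N -> R) : (lebesgue_rV N (box (fun i => `[p i, q i]%classic)) < +oo)%E.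
Proof.
have -> : lebesgue_rV N (box (fun i => `[p i, q i]%classic)) = (\prod_(i < N) lebesgue_measure `[p i, q i])%E.
  by apply: (@lebesgue_rV_box R N (fun i => `[p i, q i]%classic)).
suff : (\prod_(i < N) lebesgue_measure `[p i, q i])%E \is a fin_num.
  by rewrite fin_numElt => /andP[].
elim/big_ind : _ => [//|x y|i _]; first exact: fin_numM.
by rewrite lebesgue_measure_itv/=; case: ifPn.
Qed.

Lemma tensor_eq0 (psi : 'I_N -> R -> R) (A : 'I_N -> set R) x :
  (forall i t, ~ A i t -> psi i t = 0) -> ~ box A x -> tensor psi x = 0.
Proof.
move=> psi0 /existsNP[i Ai]; rewrite /tensor (bigD1 i)//= psi0 ?mul0r//.
Qed.

Lemma tensor01 (psi : 'I_N -> R -> R) x :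
  (forall i t, 0 <= psi i t <= 1) -> 0 <= tensor psi x <= 1.
Proof.
move=> psi01; rewrite /tensor; elim/big_ind : _ => [|a b /andP[? ?] /andP[? ?]|i _//].
  by rewrite ler01 lexx.
by rewrite mulr_ge0//= mulr_ile1.
Qed.

Lemma measurable_tensor (psi : 'I_N -> R -> R) : (forall i, measurable_fun setT (psi i)) ->
  measurable_fun setT (fun x : 'rV[R]_N => tensor psi x).
Proof.
move=> mpsi; apply: measurable_prod => i _.
exact: (measurableT_comp (mpsi i) (measurable_coord i)).
Qed.

Lemma cvg_tensor (psi : nat -> 'I_N -> R -> R) (A : 'I_N -> set R) x :
  (forall k i t, ~ A i t -> psi k i t = 0) ->
  (forall i t, A i t -> psi k i t @[k --> \oo] --> (1 : R)) ->
  tensor (psi k) x @[k --> \oo] --> (\1_(box A) x : R).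
Proof.
move=> psi0 psi1; rewrite indicE; case: (boolP (x \in box A)).
  rewrite inE => Ax; rewrite (_ : true%:R = \prod_(i < N) (1 : R)); last first.
    by rewrite big1.
  rewrite /tensor; elim: (index_enum _) => [|i s IH].
    by rewrite big_nil; under eq_cvg do rewrite big_nil; exact: cvg_cst.
  rewrite big_cons; under eq_cvg do rewrite big_cons.
  by apply: cvgM IH; apply: psi1; exact: Ax.
rewrite notin_setE => Ax; under eq_cvg do rewrite (tensor_eq0 (psi0 _) Ax).
exact: cvg_cst.
Qed.

(** The product is an admissible test function: the closed box with sides [[p i, q i]] and [[s, t]]
    is compact, and it lies in the cylinder because 0 < s, t < b and its x-part lies in [Qx]. *)
Lemma weak_derivative_tensor (Qx : set 'rV[R]_N) (b : R) (u g : V -> R)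
    (psi : 'I_N -> R -> R) (eta : R -> R) (p q : 'I_N -> R) (s t : R) :
  weak_derivative (cylinder Qx b) (dir_y R N) u g ->
  (forall i, Csmooth (psi i)) -> (forall i x, ~ `[p i, q i]%classic x -> psi i x = 0) ->
  box (fun i => `[p i, q i]%classic) `<=` Qx ->
  Csmooth eta -> (forall y, ~ `[s, t]%classic y -> eta y = 0) -> 0 < s -> t < b ->
  (\int[@lebesgue_xy R N]_(z in cylinder Qx b) (u z * (tensor psi z.1 * 'D_(1 : R) eta z.2)) =
  - \int[@lebesgue_xy R N]_(z in cylinder Qx b) (g z * (tensor psi z.1 * eta z.2)))%R.
Proof.
move=> [_ _ H] spsi psi0 pqQ seta eta0 s0 tb.
rewrite -(H (fun z => tensor psi z.1 * eta z.2)).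
  by congr Rintegral; apply/funext => z; rewrite derive_tensor.
split.
  by apply: CsmoothM; [exact: Csmooth_tensor|exact: Csmooth_snd].
exists (box (fun i => `[p i, q i]%classic) `*` `[s, t]%classic); split.
- apply: compact_setX; last exact: segment_compact.
  by apply: compact_box => i; exact: segment_compact.
- move=> [x y] [/= /pqQ ? ]; rewrite in_itv/= => /andP[sy yt]; split => //=.
  by rewrite in_itv/= (lt_le_trans s0)//= (le_lt_trans yt).
- move=> [x y] /= /not_andP[|].
    by move=> xA; rewrite (tensor_eq0 psi0)// mul0r.
  by move=> /eta0 ->; rewrite mulr0.
Qed.

End tensor.

(** * Integration against boxes *)

Section integral_complements.
Context d (T : measurableType d) (R : realType) (mu : {measure set T -> \bar R}).

Lemma integral_supp (D E : set T) (f : T -> \bar R) : E `<=` D ->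
  (forall x, D x -> ~ E x -> f x = 0%E) ->
  (\int[mu]_(x in D) f x = \int[mu]_(x in E) f x)%E.
Proof.
move=> ED f0; rewrite integral_mkcond [RHS]integral_mkcond.
apply: eq_integral => x _; rewrite !patchE.
case: (boolP (x \in D)) => [|] Dx; case: (boolP (x \in E)) => [|] Ex //.
  by apply: f0; [rewrite inE in Dx|rewrite notin_setE in Ex].
by move: Dx Ex; rewrite notin_setE inE => Dx /ED.
Qed.

Lemma Rintegral_supp (D E : set T) (f : T -> R) : E `<=` D ->
  (forall x, D x -> ~ E x -> f x = 0) ->
  (\int[mu]_(x in D) f x = \int[mu]_(x in E) f x)%R.
Proof.
by move=> ED f0; congr fine; apply: integral_supp => // x Dx Ex; rewrite f0.
Qed.

Lemma integrableM_bounded (D : set T) (f h : T -> R) (C : R) : measurable D ->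
  mu.-integrable D (EFin \o f) -> measurable_fun D h ->
  (forall x, D x -> `|h x| <= C) ->
  mu.-integrable D (EFin \o (fun x => f x * h x)).
Proof.
move=> mD fi mh hC; apply: (integrableMl mD fi mh).
exists C; split; first exact: num_real.
by move=> M CM x Dx /=; rewrite (le_trans (hC _ Dx))// ltW.
Qed.

Lemma dominated_Rcvg (D : set T) (f_ : nat -> T -> R) (f g : T -> R) :
  measurable D -> (forall n, measurable_fun D (f_ n)) ->
  (forall x, D x -> f_ n x @[n --> \oo] --> f x) ->
  mu.-integrable D (EFin \o g) -> (forall n x, D x -> `|f_ n x| <= g x) ->
  (\int[mu]_(x in D) f_ n x)%R @[n --> \oo] --> (\int[mu]_(x in D) f x)%R.
Proof.
move=> mD mf_ cf ig fg.
have mf : measurable_fun D f by exact: (measurable_fun_cvg mf_ cf).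
have [||||if_ _ cv] := @dominated_convergence _ _ _ mu D mD
    (fun n => EFin \o f_ n) (EFin \o f) (EFin \o g) _ _ _ ig.
- by move=> n; apply/measurable_EFinP; exact: mf_.
- exact/measurable_EFinP.
- by apply: aeW => x Dx; apply: cvg_EFin; [exact: nearW|exact: cf].
- by apply: aeW => x n Dx /=; rewrite lee_fin; exact: fg.
apply: fine_cvg; rewrite fineK; first exact: cv.
exact: integrable_fin_num.
Qed.

End integral_complements.

(** * Smallness of u near y = b from the trace condition *)

Section trace_bound.
Context {R : realType} {N : nat}.
Local Notation V := ('rV[R]_N * measurableTypeR R)%type.
Local Notation lam := (@lebesgue_rV R N).
Local Notation mu := (@lebesgue_measure R).
Local Notation muxy := (@lebesgue_xy R N).
Variables (Qx : set 'rV[R]_N) (b : R) (u : 'rV[R]_N * R -> R).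
Hypothesis mu0 : measurable_fun [set: V] (u \_ (cylinder Qx b)).
Variable B : set 'rV[R]_N.
Hypotheses (mB : measurable B) (Bfin : (lam B < +oo)%E).

Let L := fine ('N[lam]_2%:E[EFin \o \1_B])%E.

Lemma Lnorm2_indic_fin : 'N[lam]_2%:E[EFin \o \1_B]%E = L%:E.
Proof.
rewrite /L fineK// ge0_fin_numE; last exact: Lnorm_ge0.
rewrite unlock; apply: poweR_lty.
rewrite (_ : (\int[lam]_x _)%E = lam B)//.
rewrite -[in RHS](setIT B) -integral_indic//; apply: eq_integral => x _ /=.
by rewrite indicE; case: (_ \in _); rewrite /= ?normr1 ?normr0 ?powR1 ?powR0.
Qed.

(** Hölder with exponents 2 and 2 against the indicator of [B] trades the L^2 bound of the trace for
    an L^1 bound; [L], the L^2 norm of that indicator, is finite because [B] has finite measure. *)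
Lemma slice_L1_bound (e y : R) : 0 < y < b -> 0 <= e ->
  ('N[lam]_2%:E[EFin \o ((fun x => u (x, y) - cst 0 x)%R \_ Qx)] <= e%:E)%E ->
  (\int[lam]_x (`|(u \_ (cylinder Qx b)) (x, y)| * \1_B x)%:E <= (e * L)%:E)%E.
Proof.
move=> y0b e0.
have -> : (fun x => u (x, y) - cst 0 x) \_ Qx = fun x => (u \_ (cylinder Qx b)) (x, y).
  apply/funext => x; rewrite !patchE /= subr0.
  case: (boolP (x \in Qx)) => xQ; case: ifPn => //.
    rewrite notin_setE => -[]; split => /=; first by rewrite inE in xQ.
    exact: y0b.
  by rewrite inE => -[/= + _]; rewrite notin_setE in xQ.
move=> Ne.
have ms : measurable_fun setT (fun x => (u \_ (cylinder Qx b)) (x, y)).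
  exact: (measurable_fun_pair1 (y : measurableTypeR R) mu0).
have := @hoelder _ _ _ lam (fun x => (u \_ (cylinder Qx b)) (x, y)) (\1_B) 2 2 ms
  (measurable_indic mB) (ltr0Sn _ 1) (ltr0Sn _ 1).
have -> : 2^-1 + 2^-1 = 1 :> R by rewrite -div1r -splitr.
move=> /(_ erefl); rewrite Lnorm1 => h.
apply: le_trans (le_trans h _); last first.
  by rewrite EFinM -Lnorm2_indic_fin; apply: lee_wpmul2r => //; exact: Lnorm_ge0.
rewrite le_eqVlt; apply/orP; left; apply/eqP; apply: eq_integral => x _ /=.
by rewrite normrM [`|\1_B x|]ger0_norm.
Qed.

(** Tonelli with x integrated first reduces the claim to slices, averaged with the density [sigma].
    The trace bounds almost every slice at distance less than d from b, and [sigma] vanishes at all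
    other heights. *)
Lemma strip_L1_bound (e d : R) (sigma : R -> R) : 0 <= e ->
  {ae mu, forall y : R, 0 < y < b -> `|y - b| < d ->
      ('N[lam]_2%:E[EFin \o ((fun x => u (x, y) - cst 0 x)%R \_ Qx)] <= e%:E)%E} ->
  measurable_fun setT sigma -> (forall y, 0 <= sigma y) ->
  (forall y, ~ (0 < y < b /\ `|y - b| < d) -> sigma y = 0) ->
  (\int[mu]_y (sigma y)%:E = 1)%E ->
  (\int[muxy]_z (`|(u \_ (cylinder Qx b)) z| * \1_B z.1 * sigma z.2)%:E <= (e * L)%:E)%E.
Proof.
move=> e0 tr msig sig0 sigJ sig1.
have L0 : 0 <= L by rewrite /L fine_ge0// Lnorm_ge0.
set f := (fun z : V => (`|(u \_ (cylinder Qx b)) z| * \1_B z.1 * sigma z.2)%:E).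
have mf1 : measurable_fun [set: V] (fun z : V => `|(u \_ (cylinder Qx b)) z| * \1_B z.1).
  apply: measurable_funM; first exact: measurableT_comp.
  exact: (measurableT_comp (measurable_indic mB) measurable_fst).
have mf : measurable_fun [set: V] f.
  apply/measurable_EFinP; apply: measurable_funM => //.
  exact: (measurableT_comp msig measurable_snd).
have f0 z : (0 <= f z)%E by rewrite lee_fin !mulr_ge0.
rewrite /lebesgue_xy (fubini_tonelli2 f)//.
(* As [sigma] has mass 1, the bound is itself an integral in y, to be compared slice by slice. *)
have -> : (e * L)%:E = (\int[mu]_y ((e * L)%:E * (sigma y)%:E))%E.
  rewrite ge0_integralZl ?sig1 ?mule1//.
  - exact/measurable_EFinP.
  - by move=> y _; rewrite lee_fin.
  - by rewrite lee_fin mulr_ge0.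
apply: ae_ge0_le_integral => //.
- by move=> y _; apply: integral_ge0.
- exact: measurable_fun_fubini_tonelli_G.
- by move=> y _; rewrite mule_ge0// lee_fin// mulr_ge0.
- by apply: measurable_funeM; exact/measurable_EFinP.
move: tr; apply: filterS; first exact: (ae_filter_ringOfSetsType mu).
move=> y tr _.
rewrite /fubini_G /f /=.
under eq_integral do rewrite EFinM.
rewrite ge0_integralZr//; last 2 first.
- apply/measurable_EFinP; exact: (measurable_fun_pair1 (y : measurableTypeR R) mf1).
- by rewrite lee_fin.
have [[yb yd]|/sigJ ->] := pselect (0 < y < b /\ `|y - b| < d); last by rewrite !mule0.
apply: lee_wpmul2r; first by rewrite lee_fin.
by apply: slice_L1_bound => //; exact: tr.
Qed.

End trace_bound.

(** * The integral of u over a box in terms of its weak derivative *)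

Section box_identity.
Context {R : realType} {N : nat}.
Local Notation V := ('rV[R]_N * measurableTypeR R)%type.
Local Notation lam := (@lebesgue_rV R N).
Local Notation mu := (@lebesgue_measure R).
Local Notation muxy := (@lebesgue_xy R N).
Variables (Qx : set 'rV[R]_N) (b : R) (u g : 'rV[R]_N * R -> R).
Hypothesis wd : weak_derivative (cylinder Qx b) (dir_y R N) u g.
Hypothesis tr : trace Qx b u b (cst 0).
Hypothesis mu0 : measurable_fun [set: V] (u \_ (cylinder Qx b)).
Variables (A : 'I_N -> set R) (p q : 'I_N -> R) (I : set R) (al be : R).
Hypotheses (al0 : 0 < al) (albe : al < be) (beb : be < b).
Hypothesis pqQ : box (fun i => `[p i, q i]%classic) `<=` Qx.
Hypothesis appA : forall i, smooth_approximable (A i).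
Hypothesis Apq : forall i, A i `<=` `[p i, q i].
Hypothesis appI : smooth_approximable I.
Hypothesis Ialbe : I `<=` `]al, be[.
Hypothesis ig : muxy.-integrable (box A `*` `]al, b[) (EFin \o g).

Let Bc := box (fun i => `[p i, q i]%classic).

(** The two sides converge for different reasons. On the left u is integrable only on compact
    subsets of Q, and the part tested against [rho k] stays in one compact box independent of k. On
    the right the supports of [eta k] exhaust []al, b[], and [ig] supplies a dominating function up
    to y = b. *)
Lemma box_identity :
  (\int[muxy]_(z in box A `*` I) u z =
   - \int[muxy]_(z in box A `*` `]al, b[) (g z * fine (mu (I `&` `]-oo, z.2]))))%R.
Proof.
have mA i : measurable (A i) by exact: measurable_smooth_approximable.
have mB : measurable (box A) by exact: measurable_box.
have mBc : measurable Bc by exact: measurable_box.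
have mI : measurable I by exact: measurable_smooth_approximable.
have BBc : box A `<=` Bc by move=> x Ax i; apply: Apq; exact: Ax.
have BQ : box A `<=` Qx by exact: subset_trans BBc pqQ.
have Bfin : (lam (box A) < +oo)%E.
  apply: (@le_lt_trans _ _ (lam Bc)).
    by apply: le_measure; rewrite ?inE.
  exact: box_segment_fin.
have [rho [srho rho01 rho0 rho1]] := appI.
have rho0' k y : ~ `]al, be[%classic y -> rho k y = 0.
  by move=> nab; apply: rho0 => /Ialbe.
have /choice[psi psiP] i : exists psi : nat -> R -> R, [/\ forall k, Csmooth (psi k),
    forall k x, 0 <= psi k x <= 1, forall k x, ~ A i x -> psi k x = 0 &
    forall x, A i x -> psi k x @[k --> \oo] --> (1 : R)] by exact: appA.
pose psi' k i := psi i k.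
have spsi k i : Csmooth (psi' k i) by have [h _ _ _] := psiP i; exact: h.
have psi01 k i t : 0 <= psi' k i t <= 1 by have [_ h _ _] := psiP i; exact: h.
have psi0 k i t : ~ A i t -> psi' k i t = 0 by have [_ _ h _] := psiP i; exact: h.
have psi1 i t : A i t -> psi' k i t @[k --> \oo] --> (1 : R).
  by have [_ _ _ h] := psiP i; exact: h.
have psi0' k i t : ~ `[p i, q i]%classic t -> psi' k i t = 0.
  by move=> nt; apply: psi0 => /Apq.
have mpsi k : measurable_fun setT (fun x : 'rV[R]_N => tensor (psi' k) x).
  apply: measurable_tensor => i; apply: continuous_measurable_fun.
  exact: Csmooth_continuous.
have cpsi := cvg_tensor psi0 psi1.
have t01 k x : 0 <= tensor (psi' k) x <= 1 by exact: tensor01.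
(* Scale of the correcting bump: the denominator k + 3 puts []b - 2 de, b - de[] between [be] and
   [b] for every k, and lets it shrink towards [b]. *)
pose de (k : nat) := (b - be) / k.+3%:R.
have de0 k : 0 < de k by rewrite divr_gt0// subr_gt0.
have bede k : be <= b - de k *+ 2.
  rewrite lerBrDr -lerBrDl /de -mulrnAl -mulr_natr -mulrA ler_piMr ?subr_ge0 ?(ltW beb)//.
  by rewrite ler_pdivrMr ?mul1r ?ler_nat.
have de2 k : b - de k *+ 2 < b - de k by rewrite ltrD2l ltrN2 mulr2n ltrDl.
have /choice[sg /choice[Sg sgP]] k := normalized_bump (de2 k).
have ssg k : Csmooth (sg k) by have [[h _ _ _] _] := sgP k.
have bsg k : exists C, forall y, sg k y <= C by have [[_ h _ _] _] := sgP k.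
have dSg k : forall y, is_derive y (1 : R) (Sg k) (sg k y).
  by have [[_ _ h _] _] := sgP k.
have sg0 k y : 0 <= sg k y by have [[_ _ _ h] _] := sgP k; exact: h.
have sgJ k y : ~ `]b - de k *+ 2, b - de k[%classic y -> sg k y = 0.
  by have [_ [h _]] := sgP k; exact: h.
have Sgl k y : y <= b - de k *+ 2 -> Sg k y = 0.
  by have [_ [_ [h _ _ _]]] := sgP k; exact: h.
have Sgr k y : b - de k <= y -> Sg k y = 1.
  by have [_ [_ [_ h _ _]]] := sgP k; exact: h.
have Sg01 k y : 0 <= Sg k y <= 1 by have [_ [_ [_ _ h _]]] := sgP k; exact: h.
have sgint k : (\int[mu]_y (sg k y)%:E = 1)%E by have [_ [_ [_ _ _ h]]] := sgP k.
have msg k : measurable_fun setT (sg k).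
  by apply: continuous_measurable_fun; exact: Csmooth_continuous.
have mrho k : measurable_fun setT (rho k).
  by apply: continuous_measurable_fun; exact: Csmooth_continuous.
pose P k := primitive (rho k); pose m k := P k be; pose M := be - al.
have P0 k y : 0 <= P k y by exact: primitive_ge0.
have PM k y : P k y <= M.
  exact: (primitive_le (srho k) (rho01 k) (rho0' k) y (ltW albe)).
have Pl k y : y <= al -> P k y = 0 by exact: primitive_eq0 (rho0' k) y.
have Pr k y : be <= y -> P k y = m k.
  move=> bey; apply: EFin_inj.
  by rewrite !(primitive_ge_end (srho k) (rho01 k) (rho0' k)).
(* The bump [sg k], moved towards [y = b], makes [eta k] compactly supported in
   ]0, b[; its contribution vanishes in the limit by the trace condition. *)
pose eta k y := P k y - m k * Sg k y.
have deta k y : is_derive y (1 : R) (eta k) (rho k y - m k * sg k y).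
  apply: is_deriveB; first exact: (is_derive_primitive (srho k) (rho01 k) (rho0' k)).
have seta k : Csmooth (eta k).
  apply: Csmooth_antiderivative (deta k); apply: CsmoothD => //.
  by under eq_fun do rewrite -mulNr; exact: CsmoothZ.
have meta k : measurable_fun setT (eta k).
  by apply: continuous_measurable_fun; exact: Csmooth_continuous.
have eta0 k y : ~ `[al, b - de k]%classic y -> eta k y = 0.
  rewrite /= in_itv/= => /negP; rewrite negb_and -!ltNge => /orP[h|h].
    rewrite /eta Pl ?(ltW h)// Sgl ?mulr0 ?subrr//.
    by rewrite (le_trans _ (bede k))// ltW// (lt_trans h).
  rewrite /eta Sgr ?(ltW h)// mulr1 Pr ?subrr//.
  by rewrite (le_trans (bede k))// ltW// (lt_trans (de2 k)).
(* Both [P k y] and [m k * Sg k y] lie between 0 and [M], so their difference is bounded by [M]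
   uniformly in k. *)
have etaM k y : `|eta k y| <= M.
  have /andP[S0 S1] := Sg01 k y.
  have h1 : 0 <= m k * Sg k y by rewrite mulr_ge0 // /m.
  have h2 : m k * Sg k y <= M.
    by apply: le_trans (PM k be); rewrite -/(m k) ler_piMr // /m.
  rewrite /eta ler_norml; have := P0 k y; have := PM k y; move: h1 h2.
  by move=> h1 h2 h3 h4; apply/andP; split; lra.
have deb k : b - de k < b by rewrite ltrBlDr ltrDl.
have key k := weak_derivative_tensor wd (spsi k) (psi0' k) pqQ (seta k) (eta0 k) al0 (deb k).
(* [D k] is a compact set off which the k-th test function vanishes; [D'] is a fixed compact set
   carrying the terms in [rho k]; [D''] reaches up to y = b and is used only for g. *)
pose D k := Bc `*` `[al, b - de k]%classic : set V.
pose D' := Bc `*` `[al, be]%classic : set V.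
pose D'' := box A `*` `]al, b[%classic : set V.
have mD k : measurable (D k) by exact: measurableX.
have mD' : measurable D' by exact: measurableX.
have mD'' : measurable D'' by exact: measurableX.
have DQ k : D k `<=` cylinder Qx b.
  move=> [x y] [/= /pqQ ? ]; rewrite in_itv/= => /andP[aly yb]; split => //=.
  by rewrite in_itv/= (lt_le_trans al0)//= (le_lt_trans yb)// ltrBlDr ltrDl.
have D'D k : D' `<=` D k.
  move=> [x y] [/= ? ]; rewrite in_itv/= => /andP[aly yb]; split => //=.
  by rewrite in_itv/= aly/= (le_trans yb)// (le_trans (bede k))// ltW.
have D''Q : D'' `<=` cylinder Qx b.
  move=> [x y] [/= /BQ ? ]; rewrite in_itv/= => /andP[aly yb]; split => //=.
  by rewrite in_itv/= (lt_trans al0).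
have iu k : muxy.-integrable (D k) (EFin \o u).
  have [iu _ _] := wd; apply: iu => //; apply: compact_setX; last exact: segment_compact.
  by apply: compact_box => i; exact: segment_compact.
have iu' : muxy.-integrable D' (EFin \o u).
  exact: (integrableS (mD 0%N) mD' (D'D 0%N) (iu 0%N)).
have mtr k (h : R -> R) : measurable_fun setT h ->
    measurable_fun [set: V] (fun z : V => tensor (psi' k) z.1 * h z.2).
  move=> mh; apply: measurable_funM.
    exact: (measurableT_comp (mpsi k) measurable_fst).
  exact: (measurableT_comp mh measurable_snd).
pose f1 k (z : V) := u z * (tensor (psi' k) z.1 * rho k z.2).
pose f2 k (z : V) := u z * (tensor (psi' k) z.1 * sg k z.2).
have tr1 k (z : V) : `|tensor (psi' k) z.1 * rho k z.2| <= 1.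
  have /andP[a0 a1] := t01 k z.1; have /andP[b0 b1] := rho01 k z.2.
  by rewrite ger0_norm ?mulr_ge0// mulr_ile1.
have if1 k : muxy.-integrable (D k) (EFin \o f1 k).
  apply: (@integrableM_bounded _ _ _ _ _ _ _ 1) => //.
  by apply: measurable_funTS; exact: mtr.
have if2 k : muxy.-integrable (D k) (EFin \o f2 k).
  have [C sgC] := bsg k.
  apply: (@integrableM_bounded _ _ _ _ _ _ _ C) => //.
    by apply: measurable_funTS; exact: mtr.
  move=> z _; have /andP[a0 a1] := t01 k z.1.
  by rewrite ger0_norm ?mulr_ge0// (le_trans _ (sgC z.2))// ler_piMl.
have lhsE k : (\int[muxy]_(z in cylinder Qx b)
      (u z * (tensor (psi' k) z.1 * 'D_(1 : R) (eta k) z.2)) =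
    \int[muxy]_(z in D') f1 k z - m k * \int[muxy]_(z in D k) f2 k z)%R.
  have -> : (\int[muxy]_(z in D') f1 k z = \int[muxy]_(z in D k) f1 k z)%R.
    apply/esym/Rintegral_supp => // -[x y] [/= xB _] nD'.
    rewrite /f1 /= rho0' ?mulr0// => yI; apply: nD'; split => //=.
    exact: subset_itv_oo_cc yI.
  rewrite -RintegralZl// -RintegralB//; last first.
    exact: (integrableZl (mD k) (m k) (if2 k)).
  rewrite (@Rintegral_supp _ _ _ _ _ (D k))//.
    apply: eq_Rintegral => z _; have [_ ->] := deta k z.2; rewrite /f1 /f2; ring.
  move=> [x y] _ nD; have [_ /= ->] := deta k y.
  have [xB|xB] := pselect (Bc x); last by rewrite (tensor_eq0 (psi0' k) xB) mul0r mulr0.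
  have yD : ~ `[al, b - de k]%classic y by move=> h; exact: nD.
  rewrite rho0'; last first.
    move=> /=; rewrite in_itv/= => /andP[h1 h2]; apply: yD => /=; rewrite in_itv/= (ltW h1)/=.
    by rewrite (le_trans (ltW h2))// (le_trans (bede k))// ltW.
  rewrite sgJ ?mulr0 ?subrr ?mulr0//.
  move=> /=; rewrite in_itv/= => /andP[h1 h2]; apply: yD => /=; rewrite in_itv/= (ltW h2) andbT.
  by rewrite (le_trans (ltW albe))// (le_trans (bede k))// ltW.
have rhsE k : (\int[muxy]_(z in cylinder Qx b) (g z * (tensor (psi' k) z.1 * eta k z.2)) =
    \int[muxy]_(z in D'') (g z * (tensor (psi' k) z.1 * eta k z.2)))%R.
  apply: Rintegral_supp => // -[x y] [/= _ yb] nD.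
  have [xB|xB] := pselect (box A x); last by rewrite (tensor_eq0 (psi0 k) xB) mul0r mulr0.
  have [aly|yal] := ltP al y.
    exfalso; apply: nD; split => //=; rewrite in_itv/= aly/=.
    by move: yb; rewrite /= in_itv/= => /andP[].
  rewrite /eta Pl// Sgl ?mulr0 ?subrr ?mulr0//.
  by rewrite (le_trans yal)// (le_trans (ltW albe)).
have cvg1 : (\int[muxy]_(z in D') f1 k z)%R @[k --> \oo] -->
    (\int[muxy]_(z in box A `*` I) u z)%R.
  have -> : (\int[muxy]_(z in box A `*` I) u z =
      \int[muxy]_(z in D') (u z * (\1_(box A) z.1 * \1_I z.2)))%R.
    rewrite (@Rintegral_supp _ _ _ _ D' (box A `*` I)).
    - apply: eq_Rintegral => z; rewrite inE => -[zA zI].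
      by rewrite !indicE !mem_set// !mulr1.
    - by move=> [x y] [/= /BBc ? /Ialbe yI]; split => //=; exact: subset_itv_oo_cc yI.
    - move=> z _ /not_andP[nz|nz]; rewrite !indicE.
        by rewrite [z.1 \in _]memNset// mul0r mulr0.
      by rewrite [z.2 \in _]memNset// !mulr0.
  apply: (@dominated_Rcvg _ _ _ _ D' f1 _ (fun z => `|u z|)) => //.
  - move=> k; apply: measurable_funM; first by have /measurable_int/measurable_EFinP := iu'.
    by apply: measurable_funTS; exact: mtr.
  - move=> z _; apply: cvgM; first exact: cvg_cst.
    apply: cvgM; first exact: cpsi.
    rewrite indicE; case: (boolP (z.2 \in I)) => [|]; first by rewrite inE => /rho1.
    rewrite notin_setE => zI; under eq_cvg do rewrite rho0//.
    exact: cvg_cst.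
  - exact: (integrable_abse iu').
  - by move=> k z _; rewrite normrM ler_piMr.
have cvg2 : (\int[muxy]_(z in D'') (g z * (tensor (psi' k) z.1 * eta k z.2)))%R
    @[k --> \oo] --> (\int[muxy]_(z in box A `*` `]al, b[)
      (g z * fine (mu (I `&` `]-oo, z.2]))))%R.
  apply: (@dominated_Rcvg _ _ _ _ D'' _ _ (fun z => `|g z| * M)) => //.
  - move=> k; apply: measurable_funM; first by have /measurable_int/measurable_EFinP := ig.
    by apply: measurable_funTS; exact: mtr.
  - move=> [x y] [/= xA yb]; apply: cvgM; first exact: cvg_cst.
    rewrite -[X in _ --> X]mul1r; apply: cvgM.
      by have := cpsi x; rewrite indicE mem_set.
    rewrite -[X in _ --> X]subr0; apply: cvgB.
      exact: (cvg_primitive srho rho01 rho0 rho1 mI Ialbe).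
    (* At a fixed height y < b the correcting bump is eventually entirely above y, where its
       primitive has not yet left 0. *)
    apply: cvg_near_cst; near=> k; rewrite Sgl ?mulr0//.
    rewrite lerBrDr -lerBrDl /de -mulrnAl ler_pdivrMr// mulrC -ler_pdivrMr; last first.
      by rewrite subr_gt0; move: yb; rewrite /= in_itv/= => /andP[].
    rewrite (@le_trans _ _ k%:R)// ?ler_nat ?leqW// ltW//.
    by near: k; exact: nbhs_infty_gtr.
  - exact: (integrableZr mD'' M (integrable_abse ig)).
  - move=> k z _; rewrite normrM ler_wpM2l// normrM.
    have /andP[a0 a1] := t01 k z.1; rewrite (ger0_norm a0).
    by rewrite (le_trans _ (etaM k z.2))// ler_piMl.
have cvg3 : (m k * \int[muxy]_(z in D k) f2 k z)%R @[k --> \oo] --> (0 : R).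
  apply/cvgrPdist_le => /= e e0.
  pose L := fine ('N[lam]_2%:E[EFin \o \1_(box A)])%E.
  have L0 : 0 <= L by rewrite /L fine_ge0// Lnorm_ge0.
  have M0 : 0 < M by rewrite subr_gt0.
  have ML0 : 0 < M * L + 1 by rewrite ltr_wpDl// mulr_ge0// ltW.
  (* The summand 1 keeps the denominator positive when [L] is 0, that is, when the box is
     negligible. *)
  pose e' := e / (M * L + 1).
  have e'0 : 0 < e' by rewrite divr_gt0.
  have [_ /(_ _ e'0) [d d0 tre]] := tr.
  near=> k; rewrite sub0r normrN normrM (@le_trans _ _ (M * (e' * L)))//; last first.
    have -> : M * (e' * L) = e * ((M * L) / (M * L + 1)) by rewrite /e'; ring.
    by rewrite ler_piMr ?(ltW e0)// ler_pdivrMr// mul1r lerDl.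
  apply: ler_pM => //; first by rewrite ger0_norm /m.
  apply: (le_trans (le_normr_Rintegral (mD k) (if2 k))).
  rewrite -lee_fin /Rintegral fineK; last first.
    by apply: integrable_fin_num => //; exact: (integrable_abse (if2 k)).
  have dk : de k *+ 2 < d.
    rewrite /de -mulrnAl ltr_pdivrMr// mulrC -ltr_pdivrMr//.
    rewrite (@lt_le_trans _ _ k%:R)// ?ler_nat ?leqW//.
    by near: k; exact: nbhs_infty_gtr.
  apply: le_trans (@strip_L1_bound _ _ Qx b u mu0 (box A) mB Bfin e' d (sg k) (ltW e'0)
    tre (msg k) (sg0 k) _ (sgint k)); last first.
    move=> y ny; apply: sgJ => /=; rewrite in_itv/= => /andP[h1 h2]; apply: ny.
    have yb : y < b by rewrite (lt_trans h2)// ltrBlDr ltrDl.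
    split; first by rewrite yb andbT (lt_trans al0)// (lt_trans albe)// (le_lt_trans (bede k)).
    rewrite ltr0_norm ?subr_lt0// opprB; apply: lt_trans dk.
    by rewrite ltrBlDr -ltrBlDl.
  have mu1 : measurable_fun [set: V]
      (fun z : V => (`|(u \_ (cylinder Qx b)) z| * \1_(box A) z.1 * sg k z.2)%:E).
    apply/measurable_EFinP; apply: measurable_funM.
      apply: measurable_funM; first exact: measurableT_comp.
      exact: (measurableT_comp (measurable_indic mB) measurable_fst).
    exact: (measurableT_comp (msg k) measurable_snd).
  apply: (@le_trans _ _ (\int[muxy]_(z in D k)
      (`|(u \_ (cylinder Qx b)) z| * \1_(box A) z.1 * sg k z.2)%:E)%E); last first.
    by apply: ge0_subset_integral => // z _; rewrite lee_fin !mulr_ge0.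
  apply: ge0_le_integral => //.
  - by have /measurable_int := integrable_abse (if2 k).
  - exact: measurable_funTS.
  - move=> z Dz; rewrite lee_fin patchE mem_set; last exact: (DQ k).
    rewrite /f2 !normrM -mulrA ler_wpM2l//.
    have /andP[a0 a1] := t01 k z.1; rewrite (ger0_norm a0) (ger0_norm (sg0 _ _)) ler_wpM2r//.
    rewrite indicE; case: (boolP (z.1 \in _)) => [//|].
    by rewrite notin_setE => zA; rewrite (tensor_eq0 (psi0 k) zA).
have c1 : ((\int[muxy]_(z in D') f1 k z)%R - m k * (\int[muxy]_(z in D k) f2 k z)%R)
    @[k --> \oo] --> (\int[muxy]_(z in box A `*` I) u z)%R.
  rewrite -[X in _ --> X]subr0; exact: (cvgB cvg1 cvg3).
have c2 : (- (\int[muxy]_(z in D'') (g z * (tensor (psi' k) z.1 * eta k z.2)))%R)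
    @[k --> \oo] --> (- (\int[muxy]_(z in box A `*` `]al, b[)
      (g z * fine (mu (I `&` `]-oo, z.2]))))%R).
  exact: (cvgN cvg2).
rewrite -(cvg_lim (@Rhausdorff R) c1) -(cvg_lim (@Rhausdorff R) c2); congr (lim (_ @ \oo)).
by apply/funext => k; have := key k; rewrite lhsE rhsE.
Unshelve. all: by end_near.
Qed.
End box_identity.

(** * Tail integrals *)

Section half_space.
Context {R : realType} {N : nat}.
Local Notation V := ('rV[R]_N * measurableTypeR R)%type.

Definition half_space : set V := [set z : V | 0 < z.2].

Lemma measurable_half_space : measurable half_space.
Proof.
rewrite [X in measurable X](_ : _ = setT `*` `]0%R, +oo[%classic).
  exact: measurableX.
by apply/seteqP; split => -[x y]; rewrite /half_space/= in_itv/= andbT// => -[].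
Qed.

End half_space.

Section tail.
Context {R : realType} {N : nat}.
Local Notation V := ('rV[R]_N * measurableTypeR R)%type.
Local Notation lam := (@lebesgue_rV R N).
Local Notation mu := (@lebesgue_measure R).
Local Notation muxy := (@lebesgue_xy R N).
Variable b : R.

(** The indicator of the relation s <= y < b turns an integral with variable endpoint into a full
    integral against a measurable kernel, the form required by Tonelli. *)
Definition triangle : set (measurableTypeR R * measurableTypeR R) :=
  [set p | p.1 <= p.2 < b].

Lemma measurable_triangle : measurable triangle.
Proof.
have -> : triangle = ((fun p => p.2 - p.1) @^-1` `[0, +oo[) `&` (snd @^-1` `]-oo, b[).
  apply/seteqP; split => -[s y] /=; rewrite /triangle/= !in_itv/= andbT subr_ge0.
    by move=> /andP[].
  by move=> [-> ->].
apply: measurableI.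
  rewrite -[X in measurable X]setTI.
  have mf : measurable_fun setT (fun p : measurableTypeR R * measurableTypeR R => p.2 - p.1 : R).
    by apply: measurable_funB; [exact: measurable_snd|exact: measurable_fst].
  exact: mf.
by rewrite -[X in measurable X]setTI; apply: measurable_snd => //; exact: measurable_itv.
Qed.

(** Hardy's operator anchored at y = b. It takes extended real values, so no finiteness has to be
    known to write it down. *)
Definition tail (h : V -> \bar R) (z : V) : \bar R :=
  (\int[mu]_(y in `[z.2, b[) h (z.1, y))%E.

Lemma measurable_truncation (w : V -> \bar R) : measurable_fun setT w ->
  measurable_fun setT (fun q : V * measurableTypeR R =>
    w (q.1.1, q.2) * (\1_triangle (q.2, q.1.2))%:E)%E.
Proof.
move=> mw; apply: emeasurable_funM.
  apply: (measurableT_comp mw); apply: measurable_fun_pair => //.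
  exact: (measurableT_comp measurable_fst measurable_fst).
apply/measurable_EFinP; apply: (measurableT_comp (measurable_indic measurable_triangle)).
apply: measurable_fun_pair => //.
exact: (measurableT_comp measurable_snd measurable_fst).
Qed.

Lemma measurable_integral_truncation (w : V -> \bar R) : measurable_fun setT w ->
  (forall z, (0 <= w z)%E) ->
  measurable_fun setT (fun z : V => \int[mu]_s (w (z.1, s) * (\1_triangle (s, z.2))%:E))%E.
Proof.
move=> mw w0.
apply: (@measurable_fun_fubini_tonelli_F _ _ _ _ _ mu _ (measurable_truncation mw)).
by move=> q; rewrite mule_ge0// lee_fin.
Qed.

Variable h : V -> \bar R.
Hypotheses (mh : measurable_fun setT h) (h0 : forall z, (0 <= h z)%E).

Let k (z : V) (y : measurableTypeR R) : \bar R := (h (z.1, y) * (\1_triangle (z.2, y))%:E)%E.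

Lemma tailE z : tail h z = (\int[mu]_y k z y)%E.
Proof.
rewrite /tail integral_mkcond; apply: eq_integral => y _.
rewrite patchE /k indicE; case: ifPn => [|].
  rewrite inE /= in_itv/= => zy; rewrite mem_set ?mule1//.
by rewrite notin_setE /= in_itv/= => zy; rewrite memNset ?mule0.
Qed.

Lemma measurable_tail_kernel :
  measurable_fun setT (fun w : V * measurableTypeR R => k w.1 w.2).
Proof.
apply: emeasurable_funM.
  apply: (measurableT_comp mh); apply: measurable_fun_pair => //.
  exact: (measurableT_comp measurable_fst measurable_fst).
apply/measurable_EFinP; apply: (measurableT_comp (measurable_indic measurable_triangle)).
apply: measurable_fun_pair => //.
exact: (measurableT_comp measurable_snd measurable_fst).
Qed.

Let k0 z y : (0 <= k z y)%E.
Proof. by rewrite mule_ge0// lee_fin. Qed.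

Lemma measurable_tail : measurable_fun setT (tail h).
Proof.
have := @measurable_fun_fubini_tonelli_F _ _ _ _ _ mu _ measurable_tail_kernel (fun w => k0 w.1 w.2).
by apply: eq_measurable_fun => z _; rewrite tailE.
Qed.

Lemma tail_ge0 z : (0 <= tail h z)%E.
Proof. exact: integral_ge0. Qed.

(** Adjointness of the operators that integrate from s up to b and below y, by Tonelli in the pair
    (s, y) for each x. With [w] the indicator of a box it links [tail] to the box identity; with [w]
    a power of y it yields Hardy's inequality. *)
Lemma integral_tail (w : V -> \bar R) : measurable_fun setT w -> (forall z, (0 <= w z)%E) ->
  (\int[muxy]_z (w z * tail h z) =
   \int[muxy]_z (h z * (\int[mu]_s (w (z.1, s) * (\1_triangle (s, z.2))%:E))))%E.
Proof.
move=> mw w0.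
have mwk : measurable_fun setT (fun q : 'rV[R]_N * measurableTypeR R * measurableTypeR R =>
    w q.1 * k q.1 q.2)%E.
  apply: emeasurable_funM; last exact: measurable_tail_kernel.
  exact: (measurableT_comp mw measurable_fst).
have mw' := measurable_truncation mw.
have mF := measurable_integral_truncation mw w0.
rewrite /lebesgue_xy (fubini_tonelli1 (fun z => w z * tail h z)%E); last 2 first.
- by apply: emeasurable_funM => //; exact: measurable_tail.
- by move=> z; rewrite mule_ge0// tail_ge0.
rewrite (fubini_tonelli1 (fun z => h z * _)%E); last 2 first.
- exact: emeasurable_funM.
- by move=> z; rewrite mule_ge0// integral_ge0// => s _; rewrite mule_ge0// lee_fin.
apply: eq_integral => x _; rewrite /fubini_F /=.
have m1 : measurable_fun setT (fun p : measurableTypeR R * measurableTypeR R =>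
    w (x, p.1) * k (x, p.1) p.2)%E.
  have mp : measurable_fun setT
      (fun p : measurableTypeR R * measurableTypeR R => ((x, p.1), p.2)).
    apply: measurable_fun_pair => //; apply: measurable_fun_pair => //; exact: measurable_fst.
  exact: (measurableT_comp mwk mp).
transitivity (\int[mu]_s \int[mu]_y (w (x, s) * k (x, s) y))%E.
  apply: eq_integral => s _; rewrite tailE ge0_integralZl//.
  exact: (measurable_fun_pair2 ((x, s) : V) measurable_tail_kernel).
rewrite (@fubini_tonelli _ _ _ _ _ mu mu _ m1); last first.
  by move=> p; rewrite mule_ge0.
apply: eq_integral => y _ /=; rewrite -ge0_integralZl//.
- by apply: eq_integral => s _; rewrite /k/= muleCA.
- exact: (measurable_fun_pair2 ((x, y) : V) mw').
- by move=> s _; rewrite mule_ge0// lee_fin.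
Qed.

(** [integral_tail] for the indicator of [B] times [I]. The right-hand domain starts at [al] because
    nothing of [I] lies below a height y <= al. *)
Lemma integral_tail_box (B : set 'rV[R]_N) (I : set R) (al be : R) :
  measurable B -> measurable I -> I `<=` `]al, be[ -> be < b ->
  (\int[muxy]_(z in B `*` I) tail h z =
   \int[muxy]_(z in B `*` `]al, b[) (h z * (fine (mu (I `&` `]-oo, z.2])))%:E))%E.
Proof.
move=> mB mI Ialbe beb.
pose w (z : V) : \bar R := (\1_(B `*` I) z)%:E.
have mBI : measurable (B `*` I : set V) by exact: measurableX.
rewrite integral_mkcond.
transitivity (\int[muxy]_z (w z * tail h z))%E.
  apply: eq_integral => z _; rewrite patchE /w indicE.
  by case: ifPn => _; rewrite ?mul1e ?mul0e.
rewrite integral_tail; last 2 first.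
- by apply/measurable_EFinP; exact: measurable_indic.
- by move=> z; rewrite lee_fin.
rewrite [RHS]integral_mkcond; apply: eq_integral => -[x y] _; rewrite patchE /=.
have E : (\int[mu]_s (w (x, s) * (\1_triangle (s, y))%:E) =
    (\1_B x * (y < b)%R%:R)%:E * mu (I `&` `]-oo, y]))%E.
  rewrite -[in RHS](setIT (I `&` _)) -integral_indic//; last exact: measurableI.
  rewrite -ge0_integralZl//; last first.
    by apply/measurable_EFinP; apply: measurable_indic; exact: measurableI.
  apply: eq_integral => s _; rewrite /w -!EFinM; congr EFin.
  rewrite !indicE.
  have -> : ((x, s) \in B `*` I) = (x \in B) && (s \in I).
    by apply/idP/andP; rewrite !inE => -[].
  have -> : ((s, y) \in triangle) = (s <= y) && (y < b) by apply/idP/idP; rewrite inE.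
  have -> : (s \in I `&` `]-oo, y]) = (s \in I) && (s <= y).
    by apply/idP/andP; rewrite !inE /= in_itv.
  case: (x \in B) => /=; rewrite ?mul0r//.
  by case: (s \in I); case: (s <= y); case: (y < b); rewrite /= ?(mul0r, mul1r, mulr0, mulr1).
rewrite E; have [/[!inE] -[/= xB]|] := boolP ((x, y) \in B `*` `]al, b[).
  rewrite in_itv/= => /andP[aly yb]; rewrite yb indicE mem_set// mulr1 mul1e fineK//.
  rewrite ge0_fin_numE//; apply: (@le_lt_trans _ _ (mu `]al, be[)).
    by apply: le_measure; rewrite ?inE//; [exact: measurableI|move=> s [/Ialbe]].
  by rewrite lebesgue_measure_itv/=; case: ifPn => // _; exact: ltry.
rewrite notin_setE => /not_andP[/= xB|/= yI].
  by rewrite indicE memNset// mul0r mul0e mule0.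
have [yb|_] := ltP y b; last by rewrite mulr0 mul0e mule0.
rewrite [I `&` _](_ : _ = set0) ?measure0 ?mule0//.
apply/seteqP; split => // s [/Ialbe/=]; rewrite !in_itv/= => /andP[als _] sy.
by apply: yI; rewrite in_itv/= yb andbT (lt_le_trans als).
Qed.

End tail.

(** * Hardy's inequality *)

Section power_integrals.
Context {R : realType}.
Local Notation mu := (@lebesgue_measure R).

Lemma measurable_EFin_powR (r : R) (D : set R) :
  measurable_fun D (fun x : R => (x `^ r)%:E).
Proof. by apply/measurable_EFinP; apply: measurable_funTS; exact: measurable_powR. Qed.

Lemma powRD_gt0 (x r s : R) : 0 < x -> x `^ (r + s) = x `^ r * x `^ s.
Proof. by move=> x0; apply: powRD; apply/implyP => _; rewrite gt_eqF. Qed.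

Lemma integral_powR (r a d : R) : r != 0 -> 0 < a -> a < d ->
  (\int[mu]_(x in `[a, d]) (x `^ (r - 1))%:E = ((d `^ r - a `^ r) / r)%:E)%E.
Proof.
move=> r0 a0 ad.
have dF (x : R) : 0 < x -> is_derive x (1 : R) (fun x => r^-1 * x `^ r) (x `^ (r - 1)).
  move=> x0; rewrite [X in is_derive _ _ _ X](_ : _ = r^-1 *: (r * x `^ (r - 1))).
    exact: (@is_deriveZ _ _ _ (fun x : R => x `^ r) r^-1 x 1 _ (is_derive1_powR r x0)).
  by rewrite /GRing.scale/= mulrA mulVf// mul1r.
have cF (x : R) : 0 < x -> {for x, continuous (fun x => r^-1 * x `^ r)}.
  move=> x0; apply: differentiable_continuous; apply/derivable1_diffP.
  by have [] := dF x x0.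
rewrite (@continuous_FTC2 _ _ (fun x => r^-1 * x `^ r))//.
- by rewrite -EFinB -mulrBr mulrC.
- apply: derivable_within_continuous => x; rewrite in_itv/= => /andP[ax _].
  by have [] := @is_derive1_powR _ (r - 1) x (lt_le_trans a0 ax).
- split.
  + by move=> x; rewrite in_itv/= => /andP[ax _]; have [] := dF x (lt_trans a0 ax).
  + by apply: cvg_at_right_filter; exact: cF.
  + by apply: cvg_at_left_filter; apply: cF; exact: lt_trans ad.
- move=> x; rewrite in_itv/= => /andP[ax _].
  by rewrite derive1E; have [] := dF x (lt_trans a0 ax).
Qed.

(** The contribution of the upper endpoint is negative and is dropped, so the bound does not depend
    on [b]. *)
Lemma integral_powR_tail (ga s b : R) : 0 < ga -> 0 < s ->
  (\int[mu]_(y in `[s, b[) (y `^ (- ga - 1))%:E <= (s `^ (- ga) / ga)%:E)%E.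
Proof.
move=> ga0 s0; have [sb|bs] := ltP s b; last first.
  rewrite set_itv_ge; last by rewrite bnd_simp -leNgt.
  by rewrite integral_set0 lee_fin divr_ge0 ?powR_ge0 ?(ltW ga0).
apply: (@le_trans _ _ (\int[mu]_(y in `[s, b]) (y `^ (- ga - 1))%:E)%E).
  apply: ge0_subset_integral => //.
  - exact: measurable_EFin_powR.
  - by move=> x _; rewrite lee_fin powR_ge0.
  - by move=> x /=; rewrite !in_itv/= => /andP[-> /ltW].
rewrite integral_powR ?oppr_eq0 ?gt_eqF// lee_fin invrN mulrN -mulNr opprB.
by rewrite ler_wpM2r ?invr_ge0 ?(ltW ga0)// gerBl powR_ge0.
Qed.

(** The integrand is singular at 0 when ga < 1, so the fundamental theorem is applied on
    [[y / (n + 2), y]] and n tends to infinity; n + 2 makes the lower endpoint smaller than y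
    already for n = 0. *)
Lemma integral_powR_head (ga y : R) : 0 < ga -> 0 < y ->
  (\int[mu]_(s in `]0%R, y]) (s `^ (ga - 1))%:E <= (y `^ ga / ga)%:E)%E.
Proof.
move=> ga0 y0.
pose F n := `[y / n.+2%:R, y]%classic : set R.
have UF : `]0, y]%classic = \bigcup_n F n.
  apply/seteqP; split => x /=; rewrite in_itv/=.
    move=> /andP[x0 xy]; exists (Num.bound (y / x)) => //=; rewrite /F /= in_itv/= xy andbT.
    rewrite ler_pdivrMr// mulrC -ler_pdivrMr//.
    apply: (le_trans (ltW (archi_boundP _))); last by rewrite ler_nat -addn2 leq_addr.
    by rewrite divr_ge0 ?(ltW y0) ?(ltW x0).
  move=> [n _]; rewrite /F /= in_itv/= => /andP[yx ->]; rewrite andbT.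
  by rewrite (lt_le_trans _ yx)// divr_gt0.
have mF n : measurable (F n) by exact: measurable_itv.
have ndF : nondecreasing_seq F.
  move=> n m nm; apply/subsetPset => x; rewrite /F /= !in_itv/= => /andP[yx ->].
  rewrite andbT (le_trans _ yx)// ler_wpM2l ?(ltW y0)// lef_pV2 ?posrE//.
  by rewrite ler_nat !ltnS.
rewrite UF.
have cv : (\int[mu]_(s in F n) (s `^ (ga - 1))%:E @[n --> \oo] -->
    \int[mu]_(s in \bigcup_n F n) (s `^ (ga - 1))%:E)%E.
  apply: ge0_nondecreasing_set_cvg_integral => //.
  - by move=> n; exact: measurable_EFin_powR.
  - by move=> n x _; rewrite lee_fin powR_ge0.
rewrite -(cvg_lim _ cv)//.
apply: lime_le; first by apply/cvg_ex; eexists; exact: cv.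
apply: nearW => n; rewrite /F integral_powR ?gt_eqF//.
- by rewrite lee_fin ler_wpM2r ?invr_ge0 ?(ltW ga0)// gerBl powR_ge0.
- by rewrite divr_gt0.
- by rewrite ltr_pdivrMr// ltr_pMr// ltr1n.
Qed.

End power_integrals.

Section cauchy_schwarz.
Context d (T : measurableType d) (R : realType) (mu : {measure set T -> \bar R}).

(** Written as a product, the identity covers an infinite norm too, which is the second case of the
    proof. *)
Lemma Lnorm2_sqr (f : T -> R) :
  ('N[mu]_2%:E[EFin \o f] * 'N[mu]_2%:E[EFin \o f] = \int[mu]_x (f x ^+ 2)%:E)%E.
Proof.
have -> : (\int[mu]_x (f x ^+ 2)%:E = 'N[mu]_2%:E[EFin \o f] `^ 2)%E.
  rewrite poweR_Lnorm//; apply: eq_integral => x _ /=.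
  by rewrite powR_mulrn// real_normK// num_real.
have := Lnorm_ge0 mu 2%:E (EFin \o f).
case: ('N[mu]_2%:E[EFin \o f])%E => [r r0||//].
  by rewrite poweR_EFin powR_mulrn// expr2 EFinM.
by rewrite mulyy poweRyr.
Qed.

Lemma integral_cauchy_schwarz (D : set T) (f g : T -> R) : measurable D ->
  measurable_fun D f -> measurable_fun D g ->
  (forall x, D x -> 0 <= f x) -> (forall x, D x -> 0 <= g x) ->
  ((\int[mu]_(x in D) (f x * g x)%:E) * (\int[mu]_(x in D) (f x * g x)%:E) <=
   (\int[mu]_(x in D) (f x ^+ 2)%:E) * (\int[mu]_(x in D) (g x ^+ 2)%:E))%E.
Proof.
move=> mD mf mg f0 g0.
have mf' : measurable_fun setT (f \_ D) by exact: (measurable_restrictT f mD).1.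
have mg' : measurable_fun setT (g \_ D) by exact: (measurable_restrictT g mD).1.
have pE (k : T -> R) x : (k \_ D) x = if x \in D then k x else 0 by rewrite patchE.
have := @hoelder _ _ _ mu (f \_ D) (g \_ D) 2 2 mf' mg' (ltr0Sn _ 1) (ltr0Sn _ 1).
have -> : 2^-1 + 2^-1 = 1 :> R by rewrite -div1r -splitr.
move=> /(_ erefl); rewrite Lnorm1.
have -> : (\int[mu]_x `|(EFin \o (f \_ D \* g \_ D)%R) x| =
    \int[mu]_(x in D) (f x * g x)%:E)%E.
  rewrite [RHS]integral_mkcond; apply: eq_integral => x _ /=; rewrite !pE patchE.
  case: ifPn => [|_]; last by rewrite mul0r normr0.
  by rewrite inE => Dx; rewrite ger0_norm// mulr_ge0 ?f0 ?g0.
move=> h; apply: le_trans (lee_pmul _ _ h h) _.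
- by apply: integral_ge0 => x Dx; rewrite lee_fin mulr_ge0 ?f0 ?g0.
- by apply: integral_ge0 => x Dx; rewrite lee_fin mulr_ge0 ?f0 ?g0.
rewrite muleACA !Lnorm2_sqr le_eqVlt; apply/orP; left; apply/eqP.
by congr (_ * _)%E; rewrite [RHS]integral_mkcond; apply: eq_integral => x _;
  rewrite pE [RHS]patchE; case: ifPn => // _; rewrite expr0n.
Qed.

End cauchy_schwarz.

Section hardy.
Context {R : realType} {N : nat}.
Local Notation V := ('rV[R]_N * measurableTypeR R)%type.
Local Notation mu := (@lebesgue_measure R).
Local Notation muxy := (@lebesgue_xy R N).
Variables (b c : R) (h : V -> R).
Hypotheses (b0 : 0 < b) (c1 : 0 < c + 1).
Hypotheses (mh : measurable_fun setT h) (h0 : forall z, 0 <= h z).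
Hypothesis hb : forall z, ~ (0 < z.2 < b) -> h z = 0.

(** Splitting c as ga + (ga - 1) leaves, after Cauchy-Schwarz, the power ga - 1 of y, which is
    integrable at 0 exactly because c + 1 > 0. *)
Let ga := (c + 1) / 2.
Let ga0 : 0 < ga. Proof. by rewrite divr_gt0. Qed.
Let cE : c = ga + (ga - 1). Proof. by rewrite addrA -splitr addrK. Qed.

Let h1 (z : V) : \bar R := (h z ^+ 2 * z.2 `^ (ga + 1))%:E.

Let mh1 : measurable_fun setT h1.
Proof.
apply/measurable_EFinP; apply: measurable_funM; first exact: measurable_funX.
exact: (measurableT_comp (measurable_powR _) measurable_snd).
Qed.

Let h10 z : (0 <= h1 z)%E.
Proof. by rewrite lee_fin mulr_ge0 ?sqr_ge0// powR_ge0. Qed.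

(* Cauchy-Schwarz with the weight [y `^ (ga + 1)] gives the optimal constant [1 / ga]. *)
Lemma tail_sqr_le (z : V) : 0 < z.2 ->
  (tail b (EFin \o h) z * tail b (EFin \o h) z <= tail b h1 z * (z.2 `^ (- ga) / ga)%:E)%E.
Proof.
case: z => x s /= s0; rewrite /tail /=.
(* On [[s, b[] the product f g is h, while f^2 is the integrand [h1] and g^2 is the power - ga - 1,
   whose tail is at most s^(- ga) / ga. *)
pose f y := h (x, y) * y `^ ((ga + 1) / 2).
pose g y : R := y `^ (- ((ga + 1) / 2)).
have ipos y : y \in (`[s, b[%classic : set R) -> 0 < y.
  by rewrite inE /= in_itv/= => /andP[/(lt_le_trans s0)].
have pow2 (y r : R) : (y `^ (r / 2)) ^+ 2 = y `^ r.
  by rewrite -powR_mulrn ?powR_ge0// -powRrM -mulrA mulVf// mulr1.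
have mp r : measurable_fun (`[s, b[%classic : set R) (fun y : R => y `^ r).
  by apply: measurable_funTS; exact: measurable_powR.
have mf : measurable_fun (`[s, b[%classic : set R) f.
  apply: measurable_funM => //; apply: measurable_funTS.
  exact: (measurable_fun_pair2 (x : 'rV[R]_N) mh).
have -> : (\int[mu]_(y in `[s, b[) (h (x, y))%:E = \int[mu]_(y in `[s, b[) (f y * g y)%:E)%E.
  apply: eq_integral => y /ipos y0; by rewrite /f /g -mulrA -powRD_gt0// subrr powRr0 mulr1.
apply: le_trans (@integral_cauchy_schwarz _ _ _ mu _ f g _ mf (mp _) _ _) _ => //.
- by move=> y _; rewrite mulr_ge0 ?powR_ge0.
- by move=> y _; rewrite powR_ge0.
have -> : (\int[mu]_(y in `[s, b[) (f y ^+ 2)%:E = \int[mu]_(y in `[s, b[) h1 (x, y))%E.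
  by apply: eq_integral => y _; rewrite /f /h1 exprMn pow2.
apply: lee_wpmul2l; first exact: integral_ge0.
apply: le_trans (integral_powR_tail b ga0 s0).
rewrite le_eqVlt; apply/orP; left; apply/eqP; apply: eq_integral => y _.
by rewrite /g -mulNr pow2 opprD.
Qed.

(** Transposing [tail] leaves h^2 y^(ga + 1) times the integral over ]0, y] of s^(ga - 1) / ga, at
    most y^ga / ga^2. The total power is 2 ga + 1 = c + 2; bounding y^2 by b^2 on the support of h
    produces (b / ga)^2, the square of 2 b / (c + 1). *)
Lemma hardy_inequality :
  (\int[muxy]_(z in half_space)
     (tail b (EFin \o h) z * tail b (EFin \o h) z * (z.2 `^ c)%:E) <=
   ((2 * b / (c + 1)) ^+ 2)%:E * \int[muxy]_z (h z ^+ 2 * z.2 `^ c)%:E)%E.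
Proof.
have mD := @measurable_half_space R N.
(* What remains of the weight after [tail_sqr_le]: s^(- ga) / ga times s^c. The indicator confines
   it to s > 0, where exponents may be added. *)
pose w (z : V) : \bar R := (\1_half_space z * (ga^-1 * z.2 `^ (ga - 1)))%:E.
have mw : measurable_fun setT w.
  apply/measurable_EFinP; apply: measurable_funM; first exact: measurable_indic.
  apply: measurable_funM => //.
  exact: (measurableT_comp (measurable_powR _) measurable_snd).
have w0 z : (0 <= w z)%E.
  by rewrite lee_fin !mulr_ge0 ?powR_ge0 ?invr_ge0 ?(ltW ga0).
have mt : measurable_fun setT (tail b (EFin \o h)).
  by apply: measurable_tail => //; exact/measurable_EFinP.
have t0 z : (0 <= tail b (EFin \o h) z)%E by apply: tail_ge0 => y; rewrite lee_fin.
have mt1 := measurable_tail b mh1 h10.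
have t10 z : (0 <= tail b h1 z)%E by exact: tail_ge0.
apply: (@le_trans _ _ (\int[muxy]_z (w z * tail b h1 z))%E).
  rewrite integral_mkcond; apply: ge0_le_integral => //.
  - by move=> z _; rewrite patchE; case: ifPn => // _; rewrite !mule_ge0// lee_fin powR_ge0.
  - apply: (measurable_restrictT _ mD).1; apply: measurable_funTS; apply: emeasurable_funM.
      exact: emeasurable_funM.
    by apply/measurable_EFinP; exact: (measurableT_comp (measurable_powR _) measurable_snd).
  - exact: emeasurable_funM.
  - move=> z _; rewrite patchE; case: ifPn => [|_]; last by rewrite mule_ge0.
    rewrite inE => Dz; rewrite /w indicE mem_set// mul1r.
    apply: (@le_trans _ _ (tail b h1 z * (z.2 `^ (- ga) / ga)%:E * (z.2 `^ c)%:E)%E).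
      by rewrite lee_wpmul2r ?lee_fin ?powR_ge0// tail_sqr_le.
    rewrite muleC muleA muleAC muleC -EFinM le_eqVlt; apply/orP; left; apply/eqP.
    rewrite [RHS]muleC; congr (_ * _%:E)%E.
    rewrite mulrA -powRD_gt0//.
    by rewrite {1}cE addrAC subrr add0r mulrC.
rewrite integral_tail// -ge0_integralZl//; last 3 first.
- apply/measurable_EFinP; apply: measurable_funM; first exact: measurable_funX.
  exact: (measurableT_comp (measurable_powR _) measurable_snd).
- by move=> z _; rewrite lee_fin mulr_ge0 ?sqr_ge0// powR_ge0.
- by rewrite lee_fin sqr_ge0.
apply: ge0_le_integral => //.
- move=> z _; rewrite mule_ge0// integral_ge0// => s _; rewrite mule_ge0// lee_fin//.
- by apply: emeasurable_funM => //; exact: measurable_integral_truncation.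
- apply/measurable_EFinP; apply: measurable_funM => //; apply: measurable_funM; first exact: measurable_funX.
  exact: (measurableT_comp (measurable_powR _) measurable_snd).
move=> -[x y] _ /=.
have [/andP[y0 yb]|nb] := pselect (0 < y < b); last first.
  have -> : h (x, y) = 0 by exact: hb.
  by rewrite /h1 hb// expr0n/= !mul0r mul0e mule0.
have I : (\int[mu]_s (w (x, s) * (\1_(triangle b) (s, y))%:E) <= (ga^-1 * (y `^ ga / ga))%:E)%E.
  apply: (@le_trans _ _ (\int[mu]_(s in `]0%R, y]) (ga^-1%:E * (s `^ (ga - 1))%:E))%E).
    rewrite [leRHS]integral_mkcond; apply: ge0_le_integral => //.
    - by move=> s _; rewrite mule_ge0// lee_fin.
    - exact: (measurable_fun_pair2 ((x, y) : V) (measurable_truncation b mw)).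
    - apply: (measurable_restrictT _ (measurable_itv _)).1; apply: measurable_funeM.
      exact: measurable_EFin_powR.
    - move=> s _; rewrite patchE; case: ifPn.
        rewrite inE/= in_itv/= => /andP[s0 sy]; rewrite /w -!EFinM lee_fin.
        rewrite [\1_half_space _]indicE mem_set// mul1r ler_piMr ?mulr_ge0 ?powR_ge0 ?invr_ge0 ?(ltW ga0)//.
      rewrite notin_setE/= in_itv/= => /negP; rewrite negb_and => /orP[s0|sy].
        by rewrite /w indicE memNset ?mul0r ?mul0e//; exact/negP.
      rewrite [\1_(triangle b) _]indicE memNset ?mule0// /triangle/= => /andP[].
      by rewrite (negbTE sy).
  rewrite ge0_integralZl//.
  - by rewrite EFinM lee_wpmul2l ?lee_fin ?invr_ge0 ?(ltW ga0)//; exact: integral_powR_head.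
  - exact: measurable_EFin_powR.
  - by move=> s _; rewrite lee_fin powR_ge0.
  - by rewrite lee_fin invr_ge0 ltW.
apply: (le_trans (lee_wpmul2l (h10 _) I)); rewrite /h1 -!EFinM lee_fin/=.
have -> : 2 * b / (c + 1) = b / ga by rewrite /ga invf_div mulrCA mulrA.
rewrite [leRHS]mulrCA -mulrA ler_wpM2l ?sqr_ge0//.
have -> : y `^ (ga + 1) * (ga^-1 * (y `^ ga / ga)) = y `^ c * y ^+ 2 * (ga^-1) ^+ 2.
  rewrite (_ : y `^ c * y ^+ 2 = y `^ (ga + 1) * y `^ ga).
    by rewrite expr2; ring.
  rewrite -powR_mulrn ?(ltW y0)// -!powRD_gt0//.
  by congr (_ `^ _); rewrite {1}cE; ring.
have -> : (b / ga) ^+ 2 * y `^ c = y `^ c * b ^+ 2 * ga^-1 ^+ 2 by ring.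
by rewrite ler_wpM2r ?sqr_ge0// ler_wpM2l ?powR_ge0// ler_sqr ?nnegrE ltW.
Qed.

End hardy.

(** * Weighted integrals, Dynkin systems, cubes *)

Section weighted_integral.
Context {R : realType} {N : nat}.
Local Notation V := ('rV[R]_N * measurableTypeR R)%type.
Local Notation muxy := (@lebesgue_xy R N).
Variable c : R.
Local Notation wm := (@weighted_measure R N c).

Local Notation D := half_space.
Let mD := @measurable_half_space R N.

Let mw : measurable_fun D (fun z : V => (z.2 `^ c)%:E).
Proof.
apply: measurable_funTS; apply/measurable_EFinP.
exact: (measurableT_comp (measurable_powR _) measurable_snd).
Qed.

Let w0 (z : V) : (0 <= (z.2 `^ c)%:E)%E.
Proof. by rewrite lee_fin powR_ge0. Qed.

Lemma integral_weighted_indic (E : set V) : measurable E ->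
  (\int[wm]_z (\1_E z)%:E = \int[muxy]_(z in D) ((\1_E z)%:E * (z.2 `^ c)%:E))%E.
Proof.
move=> mE; rewrite integral_indic// setIT.
transitivity (\int[muxy]_(z in E `&` D) (z.2 `^ c)%:E)%E; first by [].
rewrite [LHS]integral_mkcond [RHS]integral_mkcond; apply: eq_integral => z _.
rewrite !patchE in_setI indicE.
by case: (z \in E); case: (z \in D); rewrite /= ?mul1e ?mul0e.
Qed.

Import HBNNSimple.

Lemma integral_weighted_nnsfun (f : {nnsfun V >-> R}) :
  (\int[wm]_z (f z)%:E = \int[muxy]_(z in D) ((f z)%:E * (z.2 `^ c)%:E))%E.
Proof.
under [LHS]eq_integral do rewrite fimfunE -fsumEFin//.
rewrite [LHS]ge0_integral_fsum//; last 2 first.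
  - by move=> r; exact/measurable_EFinP/measurableT_comp.
  - by move=> n x _; rewrite EFinM nnfun_muleindic_ge0.
under [RHS]eq_integral.
  move=> x xD; rewrite fimfunE -fsumEFin// ge0_mule_fsuml; last first.
    by move=> r; rewrite EFinM nnfun_muleindic_ge0.
  over.
rewrite [RHS]ge0_integral_fsum//; last 2 first.
  - move=> r; apply: emeasurable_funM => //; apply: measurable_funTS.
    by apply/measurable_EFinP; exact/measurableT_comp.
  - by move=> n x _; rewrite mule_ge0// EFinM nnfun_muleindic_ge0.
apply: eq_fsbigr => r /[1!inE] -[z _ fzr].
have r0 : (0 <= r%:E)%E by rewrite lee_fin -fzr.
under [LHS]eq_integral do rewrite EFinM.
rewrite ge0_integralZl//; last by apply/measurable_EFinP; exact: measurable_indic.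
rewrite integral_weighted_indic//.
under [RHS]eq_integral do rewrite EFinM -muleA.
rewrite ge0_integralZl//.
- apply: emeasurable_funM => //; apply: measurable_funTS.
  by apply/measurable_EFinP; exact: measurable_indic.
- by move=> x _; rewrite mule_ge0// lee_fin.
Qed.

(** [weighted_measure] has density y^c on the half-space; the formula passes from indicators to
    simple functions and then, by monotone convergence, to nonnegative measurable functions. *)
Lemma integral_weighted (f : V -> \bar R) : measurable_fun setT f -> (forall z, (0 <= f z)%E) ->
  (\int[wm]_z f z = \int[muxy]_(z in D) (f z * (z.2 `^ c)%:E))%E.
Proof.
move=> mf f0; pose f_ := nnsfun_approx measurableT mf.
transitivity (lim (\int[wm]_x (f_ n x)%:E @[n --> \oo])%E).
  rewrite -monotone_convergence//=.
  - apply: eq_integral => ? /[!inE] xD; apply/esym/cvg_lim => //=.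
    exact: cvg_nnsfun_approx.
  - by move=> n; exact/measurable_EFinP/measurable_funTS.
  - by move=> n ? _; rewrite lee_fin.
  - by move=> ? _ ? ? mn; rewrite lee_fin; exact/lefP/nd_nnsfun_approx.
under eq_fun do rewrite integral_weighted_nnsfun.
rewrite -monotone_convergence//=.
- apply: eq_integral => z _; apply/cvg_lim => //.
  by apply: cvgeZr => //; exact: cvg_nnsfun_approx.
- move=> n; apply: emeasurable_funM => //.
  exact/measurable_EFinP/measurable_funTS.
- by move=> n z _; rewrite mule_ge0// lee_fin.
- move=> z _ i j ij; rewrite lee_wpmul2r// lee_fin; exact/lefP/nd_nnsfun_approx.
Qed.

End weighted_integral.

Section pi_lambda.
Context d (T : measurableType d) (R : realType) (mu : {measure set T -> \bar R}).
Variables (G : set (set T)) (D : set T) (f g : T -> \bar R).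
Hypotheses (setIG : setI_closed G) (sGm : G `<=` measurable).
Hypothesis msG : measurable `<=` <<s G >>.
Hypotheses (mD : measurable D) (fi : mu.-integrable D f) (gi : mu.-integrable D g).
Hypothesis fgD : (\int[mu]_(x in D) f x = \int[mu]_(x in D) g x)%E.
Hypothesis fgG : forall E, G E ->
  (\int[mu]_(x in D `&` E) f x = \int[mu]_(x in D `&` E) g x)%E.

(** The measurable sets on which the two integrals agree form a Dynkin system: complements by
    subtracting from [fgD], which integrability makes legitimate, and disjoint unions by countable
    additivity. *)
Lemma pi_lambda_integral (E : set T) : measurable E ->
  (\int[mu]_(x in D `&` E) f x = \int[mu]_(x in D `&` E) g x)%E.
Proof.
pose H := [set E | measurable E /\
  (\int[mu]_(x in D `&` E) f x = \int[mu]_(x in D `&` E) g x)%E].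
have KC k F : measurable F -> mu.-integrable D k ->
    (\int[mu]_(x in D `&` ~` F) k x = \int[mu]_(x in D) k x - \int[mu]_(x in D `&` F) k x)%E.
  move=> mF ki; have mDF : measurable (D `&` F) by exact: measurableI.
  have mDF' : measurable (D `&` ~` F) by apply: measurableI => //; exact: measurableC.
  have DE : (D `&` ~` F) `|` (D `&` F) = D by rewrite -setIUr setUC setUv setIT.
  rewrite -[in X in _ = (X - _)%E]DE integral_setU//.
  - rewrite addeK//; apply: integrable_fin_num => //.
    by apply: integrableS ki => //; exact: subIsetl.
  - by rewrite DE; exact: measurable_int ki.
  - by apply/disj_setPS => x [[_ nF] [_ /nF]].
have dH : dynkin H.
  split => [|A [mA fgA]|F tF HF].
  - by split => //; rewrite setIT.
  - by split; [exact: measurableC|rewrite !KC// fgA fgD].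
  - have mF k : measurable (F k) by have [] := HF k.
    split; first exact: bigcupT_measurable.
    have mDF k : measurable (D `&` F k) by exact: measurableI.
    have DFs : \bigcup_k (D `&` F k) `<=` D by move=> x [k _ []].
    have mDFs : measurable (\bigcup_k (D `&` F k)) by exact: bigcupT_measurable.
    rewrite setI_bigcupr !integral_bigcup//.
    + by apply: eq_eseriesr => k _; have [] := HF k.
    + exact: trivIset_setIl.
    + exact: integrableS DFs gi.
    + exact: trivIset_setIl.
    + exact: integrableS DFs fi.
have GH : G `<=` H by move=> A GA; split; [exact: sGm|exact: fgG].
move=> mE; suff : H E by case.
apply: (lambda_system_subset setIG ((dynkin_lambda_system H).1 dH) GH) => //.
exact: msG.
Qed.

Lemma pi_lambda_ae_eq : ae_eq mu D f g.
Proof.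
apply: integral_ae_eq => //; first exact: measurable_int gi.
by move=> E ED mE; have := pi_lambda_integral mE; rewrite setIidr.
Qed.

End pi_lambda.

Section approximable_boxes.
Context {R : realType} {N : nat}.
Local Notation V := ('rV[R]_N * measurableTypeR R)%type.

Definition approx_box : set (set V) := [set E | exists A B,
  [/\ forall i, smooth_approximable (A i), smooth_approximable B & E = box A `*` B]].

Lemma approx_boxI : setI_closed approx_box.
Proof.
move=> _ _ [A [B [aA aB ->]]] [A' [B' [aA' aB' ->]]].
exists (fun i => A i `&` A' i), (B `&` B'); split.
- by move=> i; exact: smooth_approximableI.
- exact: smooth_approximableI.
- apply/seteqP; split => -[x y] /=.
    by move=> [[xA yB] [xA' yB']]; split; [move=> i; split; [exact: xA|exact: xA']|].
  move=> [xA [yB yB']]; split; split => //= i; have [] := xA i => //.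
Qed.

Lemma approx_box_measurable : approx_box `<=` measurable.
Proof.
move=> _ [A [B [aA aB ->]]]; apply: measurableX; last exact: measurable_smooth_approximable.
by apply: measurable_box => i; exact: measurable_smooth_approximable.
Qed.

(** A half-space bounding one coordinate from below is a box with approximable sides, so all
    coordinates are measurable for the generated sigma-algebra. Hence so is the identity map into V,
    which is the inclusion claimed. *)
Lemma measurable_approx_box : (measurable : set (set V)) `<=` <<s approx_box >>.
Proof.
pose W := g_sigma_algebraType approx_box.
have m1 : measurable_fun [set: W] (fun z : W => (z : V).1).
  apply/measurable_fun_rVP => i.
  apply: (measurability _ (RGenOInfty.measurableE R)) => _ [_ [a ->] <-].
  rewrite setTI; apply: sub_sigma_algebra.
  exists (fun j => if j == i then `]a, +oo[%classic else setT), setT; split.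
  - move=> j; case: ifPn => _; first exact: smooth_approximable_itvoy.
    exact: smooth_approximableT.
  - exact: smooth_approximableT.
  - apply/seteqP; split => -[x y] /=.
      by move=> h; split => // j; case: ifPn => // /eqP ->.
    by move=> [/(_ i)]; rewrite eqxx.
have m2 : measurable_fun [set: W] (fun z : W => (z : V).2).
  apply: (measurability _ (RGenOInfty.measurableE R)) => _ [_ [a ->] <-].
  rewrite setTI; apply: sub_sigma_algebra.
  exists (fun=> setT), `]a, +oo[%classic; split.
  - by move=> j; exact: smooth_approximableT.
  - exact: smooth_approximable_itvoy.
  - by apply/seteqP; split => -[x y] //= [].
have mid : measurable_fun [set: W] (fun z : W => (z : V)).
  rewrite (_ : (fun z => _) = fun z : W => ((z : V).1, (z : V).2)).
    exact: measurable_fun_pair.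
  by apply/funext => -[].
by move=> E mE; have := mid measurableT E mE; rewrite setTI.
Qed.

End approximable_boxes.

Section cubes.
Context {R : realType} {N : nat}.

Definition cube_center (j : 'rV[rat]_N * nat) (i : 'I_N) : R := ratr (j.1 ord0 i).
Definition cube_radius (j : 'rV[rat]_N * nat) : R := j.2.+1%:R^-1.
Definition open_cube j (i : 'I_N) : set R :=
  `]cube_center j i - cube_radius j, cube_center j i + cube_radius j[%classic.
Definition closed_cube j (i : 'I_N) : set R :=
  `[cube_center j i - cube_radius j, cube_center j i + cube_radius j]%classic.

(** Rational centres and radii 1/(n+1) give countably many cubes. It is the closed cube that has to
    lie in [Qx], since it will contain the supports of the test functions; a centre within r of x
    keeps it within 2 r < e of x. *)
Lemma open_cube_cover (Qx : set 'rV[R]_N) x : open Qx -> Qx x ->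
  exists2 j, box (closed_cube j) `<=` Qx & box (open_cube j) x.
Proof.
move=> oQ Qxx; have /nbhs_ballP[e /= e0 eQ] : nbhs x Qx by exact: open_nbhs_nbhs.
pose n := Num.bound (2 / e).
have rn : 2 * n.+1%:R^-1 < e.
  rewrite ltr_pdivrMr// mulrC -ltr_pdivrMr//.
  apply: (lt_le_trans (archi_boundP _)); first by rewrite divr_ge0// ltW.
  by rewrite ler_nat.
have /choice[q qP] i : exists q : rat, `|x ord0 i - ratr q| < n.+1%:R^-1 :> R.
  have [|q] := @rat_in_itvoo R (x ord0 i - n.+1%:R^-1) (x ord0 i + n.+1%:R^-1).
    by rewrite ltrBlDr -addrA ltrDl addr_gt0.
  rewrite in_itv/= => /andP[q1 q2]; exists q.
  by rewrite ltr_distlC q1 q2.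
exists (\row_i q i, n) => [v vq|i]; last first.
  rewrite /open_cube /cube_center /cube_radius /= in_itv/= mxE.
  by have := qP i; rewrite ltr_distl.
apply: eQ; split => // k i; rewrite ord1 /ball /=.
have := vq i; rewrite /closed_cube /cube_center /cube_radius /= in_itv/= mxE -ler_distl => vi.
apply: le_lt_trans (ler_distD (ratr (q i)) _ _) _.
apply: lt_le_trans (ltW rn); rewrite mulr_natl mulr2n; apply: ltr_leD; first exact: qP.
by rewrite distrC.
Qed.

End cubes.

(** * Representation of u and conclusion *)

Section representation.
Context {R : realType} {N : nat}.
Local Notation V := ('rV[R]_N * measurableTypeR R)%type.
Local Notation lam := (@lebesgue_rV R N).
Local Notation mu := (@lebesgue_measure R).
Local Notation muxy := (@lebesgue_xy R N).
Variables (Qx : set 'rV[R]_N) (b : R) (u g : 'rV[R]_N * R -> R).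
Local Notation Q := (cylinder Qx b).
Hypothesis wd : weak_derivative Q (dir_y R N) u g.
Hypothesis tr : trace Qx b u b (cst 0).
Hypothesis mu0 : measurable_fun [set: V] (u \_ Q).
Hypothesis mg0 : measurable_fun [set: V] (g \_ Q).

(** A pointwise limit of continuous functions, the primitives of the approximants of [I]. *)
Lemma measurable_measure_below (I : set R) (al be : R) : smooth_approximable I ->
  I `<=` `]al, be[ -> measurable_fun setT (fun y : R => fine (mu (I `&` `]-oo, y]))).
Proof.
move=> appI Iab; have mI := measurable_smooth_approximable appI.
have [rho [srho rho01 rho0 rho1]] := appI.
apply: (@measurable_fun_cvg _ _ _ _ (fun k => primitive (rho k))).
  move=> k; apply: continuous_measurable_fun => y.
  apply: differentiable_continuous; apply/derivable1_diffP.
  have rho0' z : ~ `]al, be[%classic z -> rho k z = 0 by move=> nab; apply: rho0 => /Iab.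
  by have [] := is_derive_primitive (srho k) (rho01 k) rho0' y.
by move=> y _; exact: (cvg_primitive srho rho01 rho0 rho1 mI Iab).
Qed.

(** Positive and negative parts of g extended by 0: their tails are defined and measurable before
    any integrability is known, and u will equal [Tn - Tp] almost everywhere. *)
Let gp (z : V) : R := Num.max ((g \_ Q) z) 0.
Let gn (z : V) : R := Num.max (- (g \_ Q) z) 0.

Let mgp : measurable_fun setT gp.
Proof. by apply: measurable_maxr. Qed.

Let mgn : measurable_fun setT gn.
Proof. by apply: measurable_maxr => //; exact: measurableT_comp. Qed.

Let gp0 z : 0 <= gp z. Proof. by rewrite le_max lexx orbT. Qed.
Let gn0 z : 0 <= gn z. Proof. by rewrite le_max lexx orbT. Qed.

Let gpn z : gn z - gp z = - (g \_ Q) z.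
Proof.
rewrite /gp /gn; have [h|h] := leP 0 ((g \_ Q) z).
  by rewrite max_r ?oppr_le0// sub0r.
by rewrite max_l ?oppr_ge0 ?subr0// ltW.
Qed.

Let gpn_norm z : gn z + gp z = `|(g \_ Q) z|.
Proof.
rewrite /gp /gn; have [h|h] := leP 0 ((g \_ Q) z).
  by rewrite max_r ?oppr_le0// add0r ger0_norm.
by rewrite max_l ?oppr_ge0 ?addr0 ?ltr0_norm// ltW.
Qed.

Let Tp := tail b (EFin \o gp).
Let Tn := tail b (EFin \o gn).

Let mTp : measurable_fun setT Tp.
Proof. by apply: measurable_tail => //; exact/measurable_EFinP. Qed.

Let mTn : measurable_fun setT Tn.
Proof. by apply: measurable_tail => //; exact/measurable_EFinP. Qed.

Let Tp0 z : (0 <= Tp z)%E. Proof. by apply: tail_ge0 => y; rewrite lee_fin. Qed.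
Let Tn0 z : (0 <= Tn z)%E. Proof. by apply: tail_ge0 => y; rewrite lee_fin. Qed.

Lemma tail_norm z : (Tn z + Tp z = tail b (fun z => `|(g \_ Q) z|%:E) z)%E.
Proof.
rewrite /Tn /Tp /tail -ge0_integralD//.
- by apply: eq_integral => y _; rewrite /= -EFinD gpn_norm.
- by move=> y _; rewrite lee_fin.
- apply: measurable_funTS; apply/measurable_EFinP.
  exact: (measurable_fun_pair2 (z.1 : 'rV[R]_N) mgn).
- by move=> y _; rewrite lee_fin.
- apply: measurable_funTS; apply/measurable_EFinP.
  exact: (measurable_fun_pair2 (z.1 : 'rV[R]_N) mgp).
Qed.

Section cell.
Variables (p q : 'I_N -> R) (al be : R).
Hypotheses (al0 : 0 < al) (albe : al < be) (beb : be < b).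
Hypothesis pqQ : box (fun i => `[p i, q i]%classic) `<=` Qx.
Hypothesis ig : muxy.-integrable (box (fun i => `[p i, q i]%classic) `*` `]al, b[) (EFin \o g).

Let Bo i := `]p i, q i[%classic.

(** [box_identity] read through [integral_tail_box], applied to [gp] and [gn] separately. The same
    transfer shows that the nonnegative tails have finite integral over the box, hence are
    integrable there, so that their difference may be integrated. *)
Lemma cell_identity (A : 'I_N -> set R) (I : set R) :
  (forall i, smooth_approximable (A i)) -> (forall i, A i `<=` Bo i) ->
  smooth_approximable I -> I `<=` `]al, be[ ->
  [/\ muxy.-integrable (box A `*` I) (EFin \o u),
      muxy.-integrable (box A `*` I) (Tn \- Tp)%E &
      (\int[muxy]_(z in box A `*` I) (EFin \o u) z =
       \int[muxy]_(z in box A `*` I) (Tn \- Tp)%E z)%E].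
Proof.
move=> appA ABo appI Iab.
have Apq i : A i `<=` `[p i, q i] by apply: subset_trans (ABo i) _; exact: subset_itv_oo_cc.
have mA i : measurable (A i) by exact: measurable_smooth_approximable.
have mB : measurable (box A) by exact: measurable_box.
have mI : measurable I by exact: measurable_smooth_approximable.
have BBc : box A `<=` box (fun i => `[p i, q i]%classic) by move=> x Ax i; apply: Apq; exact: Ax.
have BQ : box A `<=` Qx by exact: subset_trans BBc pqQ.
have mBc : measurable (box (fun i => `[p i, q i]%classic)).
  by apply: measurable_box => i; exact: measurable_itv.
pose S : set V := box A `*` `]al, b[%classic.
have mS : measurable S by exact: measurableX.
have mBI : measurable (box A `*` I : set V) by exact: measurableX.
have SQ : S `<=` Q.
  move=> [x y] [/= /BQ ? ]; rewrite in_itv/= => /andP[aly yb]; split => //=.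
  by rewrite in_itv/= (lt_trans al0).
have iu : muxy.-integrable (box A `*` I) (EFin \o u).
  have [iu _ _] := wd.
  apply: (@integrableS _ _ _ _ (box (fun i => `[p i, q i]%classic) `*` `[al, be]%classic : set V)) => //.
  - exact: measurableX.
  - by move=> [x y] [/= /BBc ? /Iab yI]; split => //=; exact: subset_itv_oo_cc yI.
  - apply: iu.
      apply: compact_setX; last exact: segment_compact.
      by apply: compact_box => i; exact: segment_compact.
    move=> [x y] [/= /pqQ ? ]; rewrite in_itv/= => /andP[aly yb]; split => //=.
    by rewrite in_itv/= (lt_le_trans al0)//= (le_lt_trans yb).
have igS : muxy.-integrable S (EFin \o g).
  apply: integrableS ig => //; first exact: measurableX.
  by move=> [x y] [/= /BBc ? ?].
pose P (z : V) := fine (mu (I `&` `]-oo, z.2])).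
have mP : measurable_fun [set: V] P.
  exact: (measurableT_comp (measurable_measure_below appI Iab) measurable_snd).
have P0 z : 0 <= P z by rewrite fine_ge0.
have PM z : `|P z| <= be - al.
  rewrite ger0_norm// -lee_fin /P fineK.
    apply: (@le_trans _ _ (mu `]al, be[)).
      by apply: le_measure; rewrite ?inE//; [exact: measurableI|move=> x [/Iab]].
    by rewrite lebesgue_measure_itv/= lte_fin albe.
  rewrite ge0_fin_numE//; apply: (@le_lt_trans _ _ (mu `]al, be[)).
    by apply: le_measure; rewrite ?inE//; [exact: measurableI|move=> x [/Iab]].
  by rewrite lebesgue_measure_itv/= lte_fin albe ltry.
have igP : muxy.-integrable S (EFin \o (fun z => g z * P z)).
  by apply: (@integrableM_bounded _ _ _ _ _ _ _ (be - al)) => //; exact: measurable_funTS.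
have igk (k : V -> R) : measurable_fun setT k -> (forall z, 0 <= k z) ->
    (forall z, k z <= `|(g \_ Q) z|) -> muxy.-integrable S (fun z => (k z)%:E * (P z)%:E)%E.
  move=> mk k0 kg; apply: le_integrable igP => //.
    apply: measurable_funTS; apply: emeasurable_funM; exact/measurable_EFinP.
  move=> z Sz; rewrite /= lee_fin !normrM ler_wpM2r// (ger0_norm (k0 z)).
  by apply: le_trans (kg z) _; rewrite patchE mem_set//; exact: SQ.
have igp := igk gp mgp gp0 (fun z => _).
have {}igp : muxy.-integrable S (fun z => (gp z)%:E * (P z)%:E)%E.
  by apply: igp => z; rewrite -gpn_norm lerDr.
have ign : muxy.-integrable S (fun z => (gn z)%:E * (P z)%:E)%E.
  by apply: igk => // z; rewrite -gpn_norm lerDl.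
have Ep : (\int[muxy]_(z in box A `*` I) Tp z = \int[muxy]_(z in S) ((gp z)%:E * (P z)%:E))%E.
  apply: (@integral_tail_box _ _ b (EFin \o gp) _ _ (box A) I al be) => //.
  - exact/measurable_EFinP.
have En : (\int[muxy]_(z in box A `*` I) Tn z = \int[muxy]_(z in S) ((gn z)%:E * (P z)%:E))%E.
  apply: (@integral_tail_box _ _ b (EFin \o gn) _ _ (box A) I al be) => //.
  - exact/measurable_EFinP.
have iTp : muxy.-integrable (box A `*` I) Tp.
  apply/integrableP; split; first exact: measurable_funTS.
  under eq_integral do rewrite gee0_abs//.
  rewrite Ep; have := integrable_fin_num mS igp.
  by rewrite fin_numElt => /andP[].
have iTn : muxy.-integrable (box A `*` I) Tn.
  apply/integrableP; split; first exact: measurable_funTS.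
  under eq_integral do rewrite gee0_abs//.
  rewrite En; have := integrable_fin_num mS ign.
  by rewrite fin_numElt => /andP[].
split => //; first exact: integrableB.
rewrite integralB// Ep En -integralB//.
have -> : (\int[muxy]_(z in S) ((gn z)%:E * (P z)%:E - (gp z)%:E * (P z)%:E) =
    \int[muxy]_(z in S) ((-1)%:E * (g z * P z)%:E))%E.
  apply: eq_integral => z; rewrite inE => Sz.
  rewrite -!EFinM -EFinB -mulrBl gpn patchE mem_set; last exact: SQ.
  by rewrite mulN1r mulNr.
have fu := integrable_fin_num mBI iu; have fg := integrable_fin_num mS igP.
rewrite integralZl// -(fineK fu) -(fineK fg) -EFinM mulN1r; congr EFin.
exact: (box_identity wd tr mu0 al0 albe beb pqQ appA Apq appI Iab igS).
Qed.

(** Boxes with approximable sides meet the cell in boxes of the same kind, to which [cell_identity]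
    applies; the pi-lambda argument then gives u = [Tn - Tp] almost everywhere on the cell, and the
    triangle inequality gives the bound. *)
Lemma cell_ae : {ae muxy, forall z, (box Bo `*` `]al, be[) z ->
  (`|u z|%:E <= tail b (fun z => `|(g \_ Q) z|%:E) z)%E}.
Proof.
have aBo i : smooth_approximable (Bo i) by exact: smooth_approximable_itvoo.
have aI : smooth_approximable `]al, be[ by exact: smooth_approximable_itvoo.
have [fi gi fgD] := @cell_identity Bo `]al, be[%classic aBo (fun i => @subset_refl _ _) aI (@subset_refl _ _).
have mD : measurable (box Bo `*` `]al, be[%classic : set V).
  by apply: measurableX => //; apply: measurable_box => i; exact: measurable_itv.
have := @pi_lambda_ae_eq _ _ _ muxy approx_box (box Bo `*` `]al, be[%classic)
  (EFin \o u) (Tn \- Tp)%E approx_boxI approx_box_measurable measurable_approx_box mD fi gi fgD.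
have H E : approx_box E ->
  (\int[muxy]_(x in (box Bo `*` `]al, be[%classic) `&` E) (EFin \o u) x =
   \int[muxy]_(x in (box Bo `*` `]al, be[%classic) `&` E) (Tn \- Tp) x)%E.
  move=> [A [B [aA aB ->]]].
  have -> : (box Bo `*` `]al, be[%classic) `&` (box A `*` B) =
      box (fun i => A i `&` Bo i) `*` (B `&` `]al, be[%classic).
    apply/seteqP; split => -[x y] /=.
      by move=> [[xB yI] [xA yB]]; split; [move=> i; split; [exact: xA|exact: xB]|].
    by move=> [xA [yB yI]]; split; split => // i; have [] := xA i.
  have [|i x []//||x []//|] := @cell_identity (fun i => A i `&` Bo i) (B `&` `]al, be[%classic).
  - by move=> i; exact: smooth_approximableI.
  - exact: smooth_approximableI.
  - by [].
move=> /(_ H); apply: filterS => z h Dz.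
rewrite -tail_norm -abse_EFin (h Dz : (u z)%:E = _).
by apply: le_trans (lee_abs_sub _ _) _; rewrite !gee0_abs.
Qed.

End cell.
End representation.

(** * Countable cover of the cylinder by cells, and local integrability *)

Section cover.
Context {R : realType} {N : nat}.
Local Notation V := ('rV[R]_N * measurableTypeR R)%type.
Local Notation lam := (@lebesgue_rV R N).
Local Notation mu := (@lebesgue_measure R).
Local Notation muxy := (@lebesgue_xy R N).
Variables (Qx : set 'rV[R]_N) (b : R).
Hypotheses (oQ : open Qx) (b0 : 0 < b).

(** The shift by 3 keeps this below b / 2, so the layer between [layer_low m] and [b - layer_low m]
    is nonempty already for m = 0. *)
Definition layer_low (m : nat) : R := b / m.+3%:R.

Lemma layer_lowP m : [/\ 0 < layer_low m, layer_low m < b - layer_low m & b - layer_low m < b].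
Proof.
have l0 : 0 < layer_low m by rewrite divr_gt0.
split => //; last by rewrite ltrBlDr ltrDl.
rewrite ltrBrDr -mulr2n -mulrnAr /layer_low -mulr_natr.
by rewrite gtr_pMr// ltr_pdivrMl// mulr1 ltr_nat.
Qed.

(** Enumeration of the pairs of a rational cube and a layer. Integers that code no pair, or a cube
    whose closure leaves [Qx], give the empty set, so that the union is exactly the cylinder. *)
Definition cell (k : nat) : set V :=
  if unpickle k is Some (j, m) then
    if `[< box (@closed_cube R N j) `<=` Qx >] then
      box (open_cube j) `*` `]layer_low m, b - layer_low m[
    else set0
  else set0.

Lemma cellP k : cell k = set0 \/ exists (j : 'rV[rat]_N * nat) m,
  box (@closed_cube R N j) `<=` Qx /\
  cell k = box (open_cube j) `*` `]layer_low m, b - layer_low m[.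
Proof.
rewrite /cell; case: unpickle => [[j m]|]; last by left.
by case: asboolP => jQ; [right; exists j, m|left].
Qed.

Lemma measurable_cell k : measurable (cell k).
Proof.
have [->//|[j [m [_ ->]]]] := cellP k.
by apply: measurableX => //; apply: measurable_box => i; exact: measurable_itv.
Qed.

Lemma cylinder_cover : cylinder Qx b = \bigcup_k cell k.
Proof.
apply/seteqP; split => [[x y] [/= Qxx]|[x y] [k _]].
  rewrite in_itv/= => /andP[y0 yb].
  have [j jQ jx] := open_cube_cover oQ Qxx.
  pose n := Num.bound (b / Num.min y (b - y)).
  have min0 : 0 < Num.min y (b - y) by rewrite lt_min y0 subr_gt0.
  have lmin : layer_low n < Num.min y (b - y).
    rewrite /layer_low ltr_pdivrMr// mulrC -ltr_pdivrMr//.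
    apply: (lt_le_trans (archi_boundP _)); first by rewrite divr_ge0// ltW.
    by rewrite ler_nat -addn3 leq_addr.
  exists (pickle (j, n)) => //; rewrite /cell pickleK; case: asboolP => // _; split => //=.
  by move: lmin; rewrite lt_min in_itv/= ltrBrDr -ltrBrDl => /andP[-> ->].
have [->//|[j [m [jQ ->]]]] := cellP k.
have [l0 _ lb] := layer_lowP m.
move=> [/= xj]; rewrite in_itv/= => /andP[ly yl]; split => /=.
  by apply: jQ => i; exact: subset_itv_oo_cc (xj i).
by rewrite in_itv/= (lt_trans l0)//= (lt_trans yl).
Qed.

Lemma measurable_cylinder : measurable (cylinder Qx b : set V).
Proof. by rewrite cylinder_cover; apply: bigcupT_measurable => k; exact: measurable_cell. Qed.

(** Each cell lies in a compact subset of the cylinder on which [f] is integrable, hence measurable;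
    countably many cells suffice. *)
Lemma measurable_locally_integrable (f : V -> R) :
  locally_integrable_on (cylinder Qx b) f -> measurable_fun [set: V] (f \_ (cylinder Qx b)).
Proof.
move=> fl; apply: (measurable_restrictT f measurable_cylinder).1.
rewrite cylinder_cover; apply/measurable_fun_bigcup; first exact: measurable_cell.
move=> k; have [->|[j [m [jQ ->]]]] := cellP k; first exact: measurable_fun_set0.
have [l0 ll lb] := layer_lowP m.
apply: (@measurable_funS _ _ _ _ (box (@closed_cube R N j) `*` `[layer_low m, b - layer_low m]%classic : set V)).
- by apply: measurableX => //; apply: measurable_box => i; exact: measurable_itv.
- move=> [x y] [/= xj yl]; split => /=; last exact: subset_itv_oo_cc yl.
  by move=> i; exact: subset_itv_oo_cc (xj i).
apply/measurable_EFinP; apply: measurable_int; apply: fl.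
  apply: compact_setX; last exact: segment_compact.
  by apply: compact_box => i; exact: segment_compact.
move=> [x y] [/= /jQ ? ]; rewrite in_itv/= => /andP[ly yl]; split => //=.
by rewrite in_itv/= (lt_le_trans l0)//= (le_lt_trans yl).
Qed.

(** With A = |g| and w = y^c one has A <= A^2 w + 1 / w, where 1 / w is bounded for al < y < b and
    the box has finite measure. *)
Lemma weighted_L2_integrable (c : R) (g : V -> R) (B : set 'rV[R]_N) (al : R) :
  measurable_fun [set: V] (g \_ (cylinder Qx b)) ->
  (\int[muxy]_(z in half_space) (((g \_ (cylinder Qx b)) z) ^+ 2 * z.2 `^ c)%:E < +oo)%E ->
  measurable B -> B `<=` Qx -> (lam B < +oo)%E -> 0 < al ->
  muxy.-integrable (B `*` `]al, b[) (EFin \o g).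
Proof.
move=> mg goo mB BQ Boo al0; pose S : set V := B `*` `]al, b[%classic.
have mS : measurable S by exact: measurableX.
have SQ : S `<=` cylinder Qx b.
  move=> [x y] [/= /BQ ? ]; rewrite in_itv/= => /andP[aly yb]; split => //=.
  by rewrite in_itv/= (lt_trans al0).
have SD : S `<=` half_space.
  by move=> [x y] [/= _]; rewrite in_itv/= => /andP[aly yb]; exact: lt_trans aly.
pose g0 := g \_ (cylinder Qx b).
suff : muxy.-integrable S (EFin \o g0).
  by apply: eq_integrable => // z; rewrite inE => Sz; rewrite /= /g0 patchE mem_set//; exact: SQ.
(* The inverse weight is monotone in y, increasing or decreasing according to the sign of c; the sum
   of its values at both ends bounds it in either case. *)
pose C := (al `^ c)^-1 + (b `^ c)^-1.
have bound (y : R) : al < y < b -> (y `^ c)^-1 <= C.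
  move=> /andP[aly yb]; have y0 : 0 < y by exact: lt_trans aly.
  have [c0|c0] := leP 0 c.
    rewrite (@le_trans _ _ (al `^ c)^-1) ?lerDl ?invr_ge0 ?powR_ge0//.
    rewrite lef_pV2 ?posrE ?powR_gt0//.
    by apply: ge0_ler_powR => //; rewrite ?nnegrE ltW.
  rewrite (@le_trans _ _ (b `^ c)^-1) ?lerDr ?invr_ge0 ?powR_ge0//.
  rewrite -!powRN; apply: ge0_ler_powR; by rewrite ?nnegrE ?oppr_ge0 ?(ltW c0) ?(ltW y0) ?(ltW b0) ?(ltW yb).
have msq : measurable_fun S (fun z : V => (g0 z ^+ 2 * z.2 `^ c)%:E).
  apply: measurable_funTS; apply/measurable_EFinP; apply: measurable_funM.
    exact: measurable_funX.
  exact: (measurableT_comp (measurable_powR _) measurable_snd).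
have C0 : 0 <= C by rewrite addr_ge0 ?invr_ge0 ?powR_ge0.
apply/integrableP; split; first by apply: measurable_funTS; exact/measurable_EFinP.
apply: (@le_lt_trans _ _ (\int[muxy]_(z in S) ((g0 z ^+ 2 * z.2 `^ c)%:E + C%:E))%E).
  apply: ge0_le_integral => //.
  - by apply: measurable_funTS; apply: measurableT_comp => //; exact/measurable_EFinP.
  - exact: emeasurable_funD.
  - move=> [x y] [/= xB]; rewrite in_itv/= => yab; rewrite -EFinD lee_fin.
    set a := g0 (x, y); set w := y `^ c.
    have w0 : 0 < w by rewrite powR_gt0//; case/andP: yab => /(lt_trans al0).
    rewrite -[a ^+ 2]real_normK ?num_real//; set A := `|a|.
    have A0 : 0 <= A by exact: normr_ge0.
    (* [A <= A ^ 2 * w + 1 / w], by comparing [A * w] with [1] *)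
    have [h|h] := leP (A * w) 1.
      rewrite (@le_trans _ _ w^-1)//; first by rewrite -[leRHS]mul1r ler_pdivlMr.
      by rewrite (le_trans (bound _ yab))// lerDr mulr_ge0 ?sqr_ge0 ?(ltW w0).
    rewrite (@le_trans _ _ (A ^+ 2 * w)) ?lerDl//.
    by rewrite expr2 -mulrA ler_peMr// ltW.
rewrite ge0_integralD//; last first.
  by move=> z _; rewrite lee_fin mulr_ge0 ?sqr_ge0 ?powR_ge0.
apply: lte_add_pinfty.
  apply: le_lt_trans goo; apply: ge0_subset_integral => //.
  - exact: measurable_half_space.
  - apply: measurable_funTS; apply/measurable_EFinP; apply: measurable_funM.
      exact: measurable_funX.
    exact: (measurableT_comp (measurable_powR _) measurable_snd).
  - by move=> z _; rewrite lee_fin mulr_ge0 ?sqr_ge0 ?powR_ge0.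
rewrite integral_cst//; apply: lte_mul_pinfty => //.
apply: (@le_lt_trans _ _ (lam B * mu `]al, b[)%E).
  by rewrite le_eqVlt; apply/orP; left; apply/eqP; exact: product_measure1E.
apply: lte_mul_pinfty => //.
  by rewrite ge0_fin_numE.
by rewrite /= lebesgue_measure_itv/=; case: ifPn => // _; exact: ltry.
Qed.

End cover.

Theorem corollary2p3 (R : realType) (N : nat) (c b : R) (Qx : set 'rV[R]_N) :
  0 < c + 1 -> 0 < b -> open Qx ->
  forall u : 'rV[R]_N * R -> R, H10 c Qx b u ->
  forall Dyu : 'rV[R]_N * R -> R,
    weak_derivative (cylinder Qx b) (dir_y R N) u Dyu ->
    (L2norm c (cylinder Qx b) u <=
     (2 * b / (c + 1))%:E * L2norm c (cylinder Qx b) Dyu)%E.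
Proof.
move=> c1 b0 oQ u [[L2u _ _] tr] g wd.
pose V := ('rV[R]_N * measurableTypeR R)%type.
pose Q := cylinder Qx b; pose u0 := u \_ Q; pose g0 := g \_ Q.
have mu0 : measurable_fun [set: V] u0.
  by move: L2u; rewrite /L2/= inE => /andP[/[!inE]].
(* [g] is an arbitrary weak derivative of u, so its measurability is drawn from its local
   integrability. *)
have mg0 : measurable_fun [set: V] g0.
  by have [_ lg _] := wd; exact: measurable_locally_integrable.
have mD := @measurable_half_space R N.
set K := 2 * b / (c + 1).
have K0 : 0 < K by rewrite divr_gt0// mulr_gt0.
have mpow : measurable_fun [set: V] (fun z : V => z.2 `^ c).
  exact: (measurableT_comp (measurable_powR _) measurable_snd).
have sqr (f : V -> R) : measurable_fun [set: V] (f \_ Q) -> (L2norm c Q f * L2norm c Q f =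
    \int[@lebesgue_xy R N]_(z in half_space) ((f \_ Q) z ^+ 2 * z.2 `^ c)%:E)%E.
  move=> mf; rewrite /L2norm Lnorm2_sqr integral_weighted//.
  - by apply/measurable_EFinP; exact: measurable_funX.
  - by move=> z; rewrite lee_fin sqr_ge0.
have nu0 : (0 <= L2norm c Q u)%E by exact: Lnorm_ge0.
have ng0 : (0 <= L2norm c Q g)%E by exact: Lnorm_ge0.
(* If the norm of g is infinite, so is the right-hand side, because the constant is positive.
   Otherwise g is in L^2_c, as the integrability on cells requires. *)
have [->|goo] := eqVneq (L2norm c Q g) +oo%E.
  by rewrite gt0_muley ?leey// lte_fin.
have gfin : L2norm c Q g \is a fin_num by rewrite ge0_fin_numE// ltey.
have sqoo : (\int[@lebesgue_xy R N]_(z in half_space) (g0 z ^+ 2 * z.2 `^ c)%:E < +oo)%E.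
  by rewrite -sqr// -(fineK gfin) -EFinM ltry.
have aeu : {ae @lebesgue_xy R N, forall z, Q z ->
    (`|u z|%:E <= tail b (fun z => `|g0 z|%:E) z)%E}.
  have : {ae @lebesgue_xy R N, forall z, forall k, cell Qx b k z ->
      (`|u z|%:E <= tail b (fun z => `|g0 z|%:E) z)%E}.
    apply: ae_foralln => k.
    have [->|[j [m [jQ ->]]]] := @cellP R N Qx b k; first exact: aeW.
    have [l0 ll lb] := layer_lowP b0 m.
    apply: (cell_ae wd tr mu0 mg0 l0 ll lb jQ).
    apply: (weighted_L2_integrable b0 mg0 sqoo) => //.
      by apply: measurable_box => i; exact: measurable_itv.
    exact: box_segment_fin.
  apply: filterS => z h Qz; have [k _ kz] : (\bigcup_k cell Qx b k) z by rewrite -cylinder_cover.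
  exact: h kz.
(* Squares of the norms are integrals over the half-space with weight y^c, so the pointwise bound by
   the tail of |g| and Hardy's inequality for |g| combine directly. *)
have sq_le : (L2norm c Q u * L2norm c Q u <= (K%:E * L2norm c Q g) * (K%:E * L2norm c Q g))%E.
  rewrite muleACA !sqr// -EFinM -expr2.
  have mag : measurable_fun [set: V] (fun z : V => `|g0 z|) by exact: measurableT_comp.
  have g0off (z : V) : ~ (0 < z.2 < b) -> `|g0 z| = 0.
    by move=> nz; rewrite /g0 patchE memNset ?normr0// => -[].
  have := hardy_inequality b0 c1 mag (fun z => normr_ge0 _) g0off.
  have -> : (\int[@lebesgue_xy R N]_z (`|g0 z| ^+ 2 * z.2 `^ c)%:E =
      \int[@lebesgue_xy R N]_(z in half_space) (g0 z ^+ 2 * z.2 `^ c)%:E)%E.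
    rewrite (@integral_supp _ _ _ _ [set: V] half_space)//.
      by apply: eq_integral => z _; rewrite real_normK// num_real.
    move=> z _ nz; rewrite g0off ?expr0n/= ?mul0r//.
    by move=> /andP[].
  apply: le_trans.
  have mt : measurable_fun [set: V] (tail b (EFin \o (fun z : V => `|g0 z|))).
    have mE : measurable_fun [set: V] (EFin \o (fun z : V => `|g0 z|)).
      exact/measurable_EFinP.
    by apply: (measurable_tail b mE) => z; rewrite lee_fin.
  have t0 z : (0 <= tail b (EFin \o (fun z : V => `|g0 z|%R)) z)%E.
    by apply: tail_ge0 => y; rewrite lee_fin.
  apply: ae_ge0_le_integral => //.
  - by move=> z _; rewrite lee_fin mulr_ge0 ?sqr_ge0 ?powR_ge0.
  - apply: measurable_funTS; apply/measurable_EFinP; apply: measurable_funM => //.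
    exact: measurable_funX.
  - by move=> z _; rewrite !mule_ge0// lee_fin powR_ge0.
  - apply: measurable_funTS; apply: emeasurable_funM; first exact: emeasurable_funM.
    exact/measurable_EFinP.
  move: aeu; apply: filterS; first exact: (ae_filter_ringOfSetsType (@lebesgue_xy R N)).
  move=> z uz _.
  rewrite EFinM; apply: lee_wpmul2r; first by rewrite lee_fin powR_ge0.
  rewrite patchE; case: ifPn => [|_]; last by rewrite expr0n/= mule_ge0.
  rewrite inE => Qz; rewrite -[_ ^+ 2]real_normK ?num_real// expr2 EFinM.
  by apply: lee_pmul; rewrite ?lee_fin//; exact: uz.
move: sq_le; rewrite -(fineK gfin) -!EFinM.
(* An infinite norm of u would have infinite square, against the finite right-hand side. *)
case: (L2norm c Q u) nu0 => [r||//] r0; last by rewrite mulyy.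
rewrite -EFinM !lee_fin -!expr2 ler_sqr ?nnegrE//.
by rewrite mulr_ge0 ?(ltW K0)// fine_ge0.
Qed.
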